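(* Let $F$ be an infinite field of characteristic $p>0$ and $n\ge 1$. There exists a complete set $\{e_{\lambda,F}:\lambda\in\Lambda^+_p(n)\}$ of pairwise orthogonal primitive idempotents of the descent algebra $\mathcal{D}_n(F)$ such that $\sum_{\lambda\in\Lambda^+_p(n)}e_{\lambda,F}=1$, $c_{n,F}(e_{\lambda,F})=\mathrm{char}_{\lambda,F}$ for every $\lambda$, and \[ e_{\lambda,F}=\frac{1}{[\lambda]!}\,\Xi^\lambda+\epsilon_\lambda,\] where $\epsilon_\lambda$ is an $F$-linear combination of elements $\Xi^\xi$ with $\xi\in\Lambda(n)$ and $\xi\prec\lambda$.
   Context: Permutations in $S_n$ act on the right and are composed left to right. A composition of $n$ is a finite sequence $q=(q_1,\dots,q_k)$ of positive integers summing to $n$; $\Lambda(n)$ is the set of compositions of $n$, $\ell(q)=k$, $q^+_j=q_1+\dots+q_j$, and $m_i(q)$ is the number of parts of $q$ equal to $i$. For $\lambda$ a partition, $[\lambda]!:=\prod_i m_i(\lambda)!$. A partition $\lambda$ of $n$ is $p$-regular if $m_i(\lambda)<p$ for all $i$; $\Lambda^+_p(n)$ denotes the set of $p$-regular partitions of $n$. Write $q\approx r$ if $r$ is a rearrangement of $q$. A composition $r$ is a (strong) refinement of $q$, written $r\leqslant q$, if $r$ is the concatenation of compositions of $q_1,q_2,\dots,q_k$ in this order; $r\preccurlyeq q$ (weak refinement) if some rearrangement of $r$ is a strong refinement of $q$; $r\prec q$ means $r\preccurlyeq q$ and $r\not\approx q$. A permutation $\sigma$ has a descent at $i$ if $(i)\sigma>(i+1)\sigma$.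 For $q\in\Lambda(n)$, $\Xi^q\in FS_n$ is the sum of all $\sigma\in S_n$ whose descents all lie in $\{q^+_1,\dots,q^+_{\ell(q)}\}$. The descent algebra $\mathcal{D}_n(F)$ is the $F$-span of $\{\Xi^q:q\in\Lambda(n)\}$ (a subalgebra of $FS_n$). For $q\in\Lambda(n)$, $\varphi^{q,F}$ is the $F$-valued permutation character of $S_n$ on the right cosets of the Young subgroup $S_{q_1}\times\cdots\times S_{q_k}$; $\mathcal{C}_n(F)$ is the $F$-span of these class functions, and the Solomon epimorphism is the surjective $F$-algebra homomorphism $c_{n,F}:\mathcal{D}_n(F)\to\mathcal{C}_n(F)$, $\Xi^q\mapsto\varphi^{q,F}$. Two partitions $\lambda,\mu$ of $n$ are $p$-equivalent if the $p'$-parts of permutations of cycle types $\lambda$ and $\mu$ are conjugate in $S_n$; each $p$-equivalence class contains exactly one $p$-regular partition. For $\lambda\in\Lambda^+_p(n)$, $\mathcal{C}_{\lambda,p}$ is the set of permutations whose cycle type is $p$-equivalent to $\lambda$, and $\mathrm{char}_{\lambda,F}$ is the characteristic function of $\mathcal{C}_{\lambda,p}$. *)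

(* Defs.v *)
From HB Require Import structures.
From mathcomp Require Import all_boot all_order all_algebra all_fingroup all_solvable.
Set Implicit Arguments. Unset Strict Implicit. Unset Printing Implicit Defensive.
Import GRing.Theory.
Local Open Scope ring_scope.

Definition is_comp (n : nat) (q : seq nat) : bool :=
  all (fun x => 0 < x)%N q && (sumn q == n).

Fixpoint comps_aux (fuel m : nat) : seq (seq nat) :=
  match fuel with
  | 0 => if m == 0%N then [:: [::]] else [::]
  | f.+1 => if m == 0%N then [:: [::]]
            else flatten [seq map (cons k) (comps_aux f (m - k)) | k <- iota 1 m]
  end.

Definition compositions (n : nat) : seq (seq nat) := comps_aux n n.

Definition is_partition (n : nat) (l : seq nat) : bool :=
  is_comp n l && sorted geq l.

Definition preg_part (p n : nat) (l : seq nat) : bool :=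
  is_partition n l && all (fun i => count_mem i l < p)%N l.

Definition preg_parts (p n : nat) : seq (seq nat) :=
  [seq l <- compositions n | preg_part p n l].

Definition mult_fact (l : seq nat) : nat :=
  (\prod_(i <- undup l) (count_mem i l)`!)%N.

Definition strong_refines (r q : seq nat) : Prop :=
  exists rs : seq (seq nat),
    [/\ map sumn rs = q, all (all (fun x => 0 < x)%N) rs & flatten rs = r].

Definition weak_refines (r q : seq nat) : Prop :=
  exists r', perm_eq r' r /\ strong_refines r' q.

Definition strict_weak_refines (r q : seq nat) : Prop :=
  weak_refines r q /\ ~~ perm_eq r q.

Definition psums (q : seq nat) : seq nat :=
  [seq sumn (take j q) | j <- iota 1 (size q)].

(* Points {1,...,n} are represented by 'I_n (point i+1 <-> ordinal i).
   Permutations act on the right: (i)s is s i, and s * t in mathcomp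
   satisfies (s * t) i = t (s i), i.e. composition left to right. *)

Section GroupAlgebra.
Variables (F : fieldType) (n : nat).

Local Notation FS := {ffun 'S_n -> F}.

Definition ga_mul (x y : FS) : FS :=
  [ffun t => \sum_(s : 'S_n) x s * y (s^-1 * t)%g].

Definition ga_one : FS := [ffun s => (s == 1%g)%:R].

(* s has a descent at position i (1-based): (i)s > (i+1)s *)
Definition is_descent (s : 'S_n) (i : nat) : bool :=
  [exists j : 'I_n, exists k : 'I_n,
     [&& (j.+1 == i)%N, (val k == i)%N & (s k < s j)%N]].

Definition Xi (q : seq nat) : FS :=
  [ffun s => if [forall i : 'I_n, is_descent s i ==> (val i \in psums q)]
             then 1 else 0].

Definition lincomb (a : seq nat -> F) (f : seq nat -> FS) : FS :=
  [ffun s => \sum_(q <- compositions n) a q * f q s].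

Definition in_descent_alg (x : FS) : Prop :=
  exists a : seq nat -> F, x = lincomb a Xi.

Definition idem (x : FS) : Prop := ga_mul x x = x.

Definition primitive_idem (e : FS) : Prop :=
  [/\ in_descent_alg e, e != 0, idem e &
     forall f g : FS, in_descent_alg f -> in_descent_alg g ->
       idem f -> idem g -> ga_mul f g = 0 -> ga_mul g f = 0 ->
       e = f + g -> f = 0 \/ g = 0].

(* block index of point i (0-based) for the composition q *)
Definition block (q : seq nat) (i : 'I_n) : nat := count (fun t => t <= i)%N (psums q).

Definition young (q : seq nat) : {set 'S_n} :=
  [set s : 'S_n | [forall i : 'I_n, block q (s i) == block q i]].

Definition perm_char (q : seq nat) : FS :=
  [ffun g => (#|[set C in rcosets (young q) [set: 'S_n] | (C :* g)%g == C]|)%:R].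

Definition cycle_type (s : 'S_n) : seq nat :=
  sort geq [seq #|C| | C : {set 'I_n} <- enum (porbits s)].

(* g lies in C_{lambda,p}: cycle type of g is p-equivalent to lambda *)
Definition in_pclass (p : nat) (l : seq nat) (g : 'S_n) : bool :=
  [exists h : 'S_n, (cycle_type h == l) &&
     (constt g p^' \in (constt h p^' ^: [set: 'S_n])%g)].

Definition char_fun (p : nat) (l : seq nat) : FS :=
  [ffun g => (in_pclass p l g)%:R].

End GroupAlgebra.

(* Main.v *)
Require Import Defs.
From HB Require Import structures.
From mathcomp Require Import all_boot all_order all_algebra all_fingroup all_solvable.
Import GRing.Theory.
Set Implicit Arguments. Unset Strict Implicit. Unset Printing Implicit Defensive.
Local Open Scope ring_scope.

(** Index compositions of m + 1 by their sets E of break points. Solomon's rule writes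
    XI E * XI G as a sum of XI (E :|: asc v) over colourings v with the content of G that
    increase weakly on the blocks of E. Hence right multiplication by an element x of the
    descent algebra is triangular in the basis XI, with diagonal entries chi E x; these
    entries are the characters of the algebra, chi E (XI G) being the value of the Young
    permutation character of G at a permutation whose cycles are the blocks of E, and an
    element killed by all of them is nilpotent. In characteristic p the value of a
    permutation character at g only depends on the p'-part of g, so only the characters
    indexed by p-regular partitions matter; that every g is p-equivalent to a p-regular
    partition follows by counting: the map from p-regular partitions to p'-cycle types is
    injective, because phi l l = [l]! is nonzero in F, and Glaisher's merging of p equal
    parts bounds the number of p'-cycle types.
    Running through the p-regular partitions l by decreasing length, let S be the sum of
    the idempotents already found and y = (1 - S) (XI l / [l]!) (1 - S). Then y is
    congruent to XI l / [l]! modulo the ideal spanned by the strictly finer XI w, and y is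
    idempotent up to a nilpotent element, so 1 - (1 - y^N)^N is the next idempotent. *)

(** * The group algebra as an algebra over [F] *)

Section GroupAlgebraRing.
Variables (F : fieldType) (n : nat).

(* A copy of the function space: {ffun 'S_n -> F} itself carries the pointwise ring structure. *)
Definition galg := {ffun 'S_n -> F}.

HB.instance Definition _ := GRing.Zmodule.on galg.

Definition galg_scale (c : F) (x : galg) : galg := [ffun s => c * x s].

Lemma ga_mulA : associative (@ga_mul F n : galg -> galg -> galg).
Proof.
move=> x y z; apply/ffunP=> t; rewrite !ffunE.
transitivity (\sum_s \sum_u x s * (y u * z (u^-1 * (s^-1 * t))%g)).
  by apply: eq_bigr => s _; rewrite ffunE mulr_sumr.
rewrite exchange_big /= [RHS](_ : _ =
  \sum_u \sum_s x s * y (s^-1 * u)%g * z (u^-1 * t)%g); last first.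
  by apply: eq_bigr => u _; rewrite ffunE mulr_suml.
rewrite [LHS]exchange_big [RHS]exchange_big /=; apply: eq_bigr => s _.
rewrite [RHS](reindex_inj (mulgI s)) /=; apply: eq_bigr => u _.
by rewrite mulKg invMg !mulgA mulrA.
Qed.

Lemma ga_mul1 : left_id (ga_one F n) (@ga_mul F n : galg -> galg -> galg).
Proof.
move=> x; apply/ffunP=> t; rewrite ffunE (bigD1 1%g) //= big1 ?addr0.
  by rewrite ffunE eqxx mul1r invg1 mul1g.
by move=> s /negPf ns; rewrite ffunE ns mul0r.
Qed.

Lemma ga_mulr1 : right_id (ga_one F n) (@ga_mul F n : galg -> galg -> galg).
Proof.
move=> x; apply/ffunP=> t; rewrite ffunE (bigD1 t) //= big1 ?addr0.
  by rewrite ffunE mulVg eqxx mulr1.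
by move=> s /negPf ns; rewrite ffunE -eq_mulVg1 ns mulr0.
Qed.

Lemma ga_mulDl : left_distributive (@ga_mul F n : galg -> galg -> galg) +%R.
Proof.
move=> x y z; apply/ffunP=> t; rewrite !ffunE -big_split /=.
by apply: eq_bigr => s _; rewrite ffunE mulrDl.
Qed.

Lemma ga_mulDr : right_distributive (@ga_mul F n : galg -> galg -> galg) +%R.
Proof.
move=> x y z; apply/ffunP=> t; rewrite !ffunE -big_split /=.
by apply: eq_bigr => s _; rewrite ffunE mulrDr.
Qed.

Lemma ga_one_neq0 : ga_one F n != 0 :> galg.
Proof.
apply/eqP=> /ffunP/(_ 1%g); rewrite !ffunE eqxx => /eqP.
by rewrite oner_eq0.
Qed.

HB.instance Definition _ := GRing.Zmodule_isNzRing.Build galg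
  ga_mulA ga_mul1 ga_mulr1 ga_mulDl ga_mulDr ga_one_neq0.

Lemma galg_scaleA a b (x : galg) :
  galg_scale a (galg_scale b x) = galg_scale (a * b) x.
Proof. by apply/ffunP=> s; rewrite !ffunE mulrA. Qed.
Lemma galg_scale1 : left_id 1 galg_scale.
Proof. by move=> x; apply/ffunP=> s; rewrite !ffunE mul1r. Qed.
Lemma galg_scaleDr : right_distributive galg_scale +%R.
Proof. by move=> a x y; apply/ffunP=> s; rewrite !ffunE mulrDr. Qed.
Lemma galg_scaleDl (x : galg) : {morph galg_scale^~ x : a b / a + b}.
Proof. by move=> a b; apply/ffunP=> s; rewrite !ffunE mulrDl. Qed.

HB.instance Definition _ := GRing.Zmodule_isLmodule.Build F galg
  galg_scaleA galg_scale1 galg_scaleDr galg_scaleDl.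

Lemma galg_scaleAl (a : F) (x y : galg) : a *: (x * y) = (a *: x) * y.
Proof.
apply/ffunP=> t; rewrite !ffunE mulr_sumr.
by apply: eq_bigr => s _; rewrite ffunE mulrA.
Qed.
HB.instance Definition _ := GRing.Lmodule_isLalgebra.Build F galg galg_scaleAl.

Lemma galg_scaleAr (a : F) (x y : galg) : a *: (x * y) = x * (a *: y).
Proof.
apply/ffunP=> t; rewrite !ffunE mulr_sumr.
by apply: eq_bigr => s _; rewrite ffunE mulrCA.
Qed.
HB.instance Definition _ := GRing.Lalgebra_isAlgebra.Build F galg galg_scaleAr.

Lemma galgZE a (x : galg) s : (a *: x) s = a * x s.
Proof. by rewrite ffunE. Qed.

Lemma galg_mulE (x y : galg) t : (x * y) t = \sum_s x s * y (s^-1 * t)%g.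
Proof. by rewrite ffunE. Qed.

End GroupAlgebraRing.

(** * Descent sets and blocks *)

Section Blocks.
Variable m : nat.
Implicit Types (E G : {set 'I_m}) (x y : 'I_m.+1) (i : 'I_m) (s t : 'S_m.+1).

Definition pt i : 'I_m.+1 := widen_ord (leqnSn m) i.
Definition nx i : 'I_m.+1 := lift ord0 i.

Definition des s : {set 'I_m} := [set i | (s (nx i) < s (pt i))%N].

(* Breaks [i \in E] separate the points [i] and [i.+1]; [blk E] numbers the
   resulting intervals from 0. *)
Definition blk E x : nat := #|[set i in E | (i < x)%N]|.

Lemma val_nx i : nx i = i.+1 :> nat. Proof. by []. Qed.

Lemma blk_le E x y : (x <= y)%N -> (blk E x <= blk E y)%N.
Proof.
move=> lexy; apply/subset_leq_card/subsetP=> i; rewrite !inE => /andP[-> ltix] /=.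
exact: leq_trans lexy.
Qed.

Lemma blk_lt E x y : (blk E x < blk E y)%N -> (x < y)%N.
Proof. by rewrite ltnNge => /negP h; rewrite ltnNge; apply/negP=> /blk_le. Qed.

Lemma blk_nx E i : blk E (nx i) = ((i \in E) + blk E (pt i))%N.
Proof.
case: (boolP (i \in E)) => iE /=; last first.
  apply: eq_card => j; rewrite !inE val_nx ltnS leq_eqVlt.
  case: (eqVneq (j : nat) i) => //= /val_inj ->.
  by rewrite (negPf iE).
rewrite /blk (cardsD1 i) inE iE val_nx leqnn /=; congr (_ + _)%N.
apply: eq_card => j; rewrite !inE ltnS (leq_eqVlt j) -(inj_eq val_inj) /=.
by case: (eqVneq (j : nat) i) => [->|//]; rewrite ltnn andbF.
Qed.

Lemma blk_bound E x : (blk E x < m.+1)%N.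
Proof. by rewrite ltnS (leq_trans (max_card _)) ?card_ord. Qed.

Lemma pt_nx_ind (R : 'I_m.+1 -> 'I_m.+1 -> Prop) x y :
  (forall x y z, R x y -> R y z -> R x z) ->
  (forall i, (x <= i < y)%N -> R (pt i) (nx i)) -> (x < y)%N -> R x y.
Proof.
move=> trR; case: y => y /=; elim: y => // y IH ly hR.
have step : (x <= y)%N -> R (inord y) (Ordinal ly).
  move=> lexy; have := hR (Ordinal (ly : (y < m)%N)); rewrite /= lexy ltnSn => /(_ isT).
  set a := pt _; set b := nx _.
  have -> : a = inord y by apply: val_inj; rewrite /= inordK // ltnW.
  by have -> : b = Ordinal ly by apply: val_inj.
rewrite ltnS leq_eqVlt => /orP[/eqP exy|ltxy].
  by rewrite -[x]inord_val exy; apply: step; rewrite exy.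
have ly' := ltnW ly; apply: trR (step (ltnW ltxy)).
have -> : inord y = Ordinal ly' by apply: val_inj; rewrite /= inordK.
by apply: IH => // j /andP[lexj ltjy]; apply: hR; rewrite lexj ltnS ltnW.
Qed.

Lemma desPn s i : (i \notin des s) = (s (pt i) < s (nx i))%N.
Proof.
rewrite inE -leqNgt leq_eqVlt; case: eqVneq => //= /val_inj/perm_inj/(congr1 val) /= /eqP.
by rewrite /bump /= add1n -[X in X == _]addn0 -addn1 eqn_add2l.
Qed.

Lemma des_subP s E :
  reflect (forall x y, (x < y)%N -> blk E x = blk E y -> (s x < s y)%N) (des s \subset E).
Proof.
apply: (iffP subsetP) => [sE x y ltxy eqb | h i].
  apply: (@pt_nx_ind (fun a b => s a < s b)%N) ltxy => [a b c|i /andP[lexi ltiy]].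
    exact: ltn_trans.
  rewrite -desPn; apply/negP=> /sE iE.
  have := blk_le E (lexi : (x <= pt i)%N); have := blk_le E (ltiy : (nx i <= y)%N).
  rewrite blk_nx iE eqb add1n => h1 h2.
  by have := leq_trans h1 h2; rewrite ltnn.
apply: contraLR => iE; rewrite desPn; apply: h; first by rewrite val_nx.
by rewrite blk_nx (negPf iE).
Qed.

Lemma blk_const E (T : eqType) (v : 'I_m.+1 -> T) :
  (forall i, i \notin E -> v (pt i) = v (nx i)) ->
  forall x y, blk E x = blk E y -> v x = v y.
Proof.
move=> h; suff main x y : (x < y)%N -> blk E x = blk E y -> v x = v y.
  move=> x y eb; case: (ltngtP x y) => [l|l|/val_inj -> //]; first exact: main.
  by apply/esym/main.
move=> ltxy eqb.
apply: (@pt_nx_ind (fun a b => v a = v b)) ltxy => [a b c -> //|i /andP[lexi ltiy]].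
apply: h; apply/negP => iE.
have := blk_le E (lexi : (x <= pt i)%N); have := blk_le E (ltiy : (nx i <= y)%N).
rewrite blk_nx iE eqb add1n => h1 h2.
by have := leq_trans h1 h2; rewrite ltnn.
Qed.

(** A strictly increasing self-map of an initial segment never lies below the identity; this applies
    to both [s] and its inverse. *)
Lemma perm_mono_id s : (forall x y, (x < y)%N -> (s x < s y)%N) -> s = 1%g.
Proof.
move=> mono; apply/permP=> x; rewrite perm1; apply/val_inj/anti_leq/andP.
have ge (t : 'S_m.+1) : (forall x y, (x < y)%N -> (t x < t y)%N) -> forall x, (x <= t x)%N.
  move=> mt; case=> k /=; elim: k => // k IH lk.
  exact: leq_ltn_trans (IH (ltnW lk)) (mt (Ordinal (ltnW lk)) (Ordinal lk) (ltnSn k)).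
split; last exact: ge.
suff /ge/(_ (s x)) : forall a b : 'I_m.+1, (a < b)%N -> (s^-1%g a < s^-1%g b)%N by rewrite permK.
move=> a b; rewrite ltnNge => h; rewrite ltnNge; apply: contra h.
rewrite leq_eqVlt => /orP[/eqP/val_inj/perm_inj -> //|/mono].
by rewrite !permKV => /ltnW.
Qed.

Definition young_set E s := forall x, blk E (s x) = blk E x.

(* The increasing representative maximises [\sum_x x * (y * w) x] over the coset. *)
Lemma young_coset_ex E s : exists2 y, young_set E y & des (y * s)%g \subset E.
Proof.
pose P (y : 'S_m.+1) := [forall x, blk E (y x) == blk E x].
pose f (y : 'S_m.+1) := (\sum_(x : 'I_m.+1) x * s (y x))%N.
have P1 : P 1%g by apply/forallP=> x; rewrite perm1.
case: (@arg_maxnP _ 1%g P f P1) => y /forallP Py max_y.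
exists y => [x|]; first exact/eqP.
apply/subsetP=> i; apply: contraLR => iE; apply/negP => idy.
pose t := tperm (pt i) (nx i).
have eb : blk E (nx i) = blk E (pt i) by rewrite blk_nx (negPf iE).
have Pt : P (t * y)%g.
  apply/forallP=> x; rewrite permM (eqP (Py _)); apply/eqP.
  by rewrite /t; case: tpermP => [->|->|//].
have ne : nx i != pt i by rewrite -(inj_eq val_inj) /= /bump /= add1n eqn_leq ltnn.
have sumE (g : 'I_m.+1 -> nat) : (\sum_(x : 'I_m.+1) x * g x =
    i * g (pt i) + i.+1 * g (nx i) +
    \sum_(x : 'I_m.+1 | (x != pt i) && (x != nx i)) x * g x)%N.
  by rewrite (bigD1 (pt i)) //= (bigD1 (nx i)) //= addnA.
have := max_y _ Pt; rewrite /geq /= leqNgt; case/negP.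
rewrite /f (sumE (fun x => s (y x))) (sumE (fun x => s ((t * y)%g x))).
rewrite !permM tpermL tpermR.
rewrite [X in (_ < _ + X)%N](eq_bigr (fun x : 'I_m.+1 => x * s (y x))%N); last first.
  by move=> x /andP[n1 n2]; rewrite permM tpermD // eq_sym.
rewrite ltn_add2r; move: idy; rewrite inE !permM.
move: (nat_of_ord (s _)) (nat_of_ord (s _)) => a b ltab.
by rewrite !mulSn addnCA [X in (_ < X)%N]addnCA (addnC (i * b))%N ltn_add2r.
Qed.

(** Inside a block, [y] must preserve the order because both [s] and [y * s] increase there; between
    blocks it does so because it preserves the blocks. Hence [y] is increasing. *)
Lemma young_coset_uniq E (y s : 'S_m.+1) :
  young_set E y -> des s \subset E -> des (y * s)%g \subset E -> y = 1%g.
Proof.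
move=> yE /des_subP sE /des_subP ysE; apply: perm_mono_id => x x' lt.
have := blk_le E (ltnW lt); rewrite leq_eqVlt => /orP[/eqP eb|].
  have := ysE _ _ lt eb; rewrite !permM.
  apply: contraLR; rewrite -!leqNgt leq_eqVlt => /orP[/eqP/val_inj ->//|/sE h].
  by apply/ltnW/h; rewrite !yE.
by rewrite -(yE x) -(yE x') => /blk_lt.
Qed.

(** Start from the order reversal and take the increasing representative of its Young coset: its
    descents lie in [E], and at a break in [E] the reversal forces a descent. *)
Lemma des_ex E : exists s, des s = E.
Proof.
have [y yE sE] := young_coset_ex E (perm (@rev_ord_inj m.+1)).
exists (y * perm (@rev_ord_inj m.+1))%g; apply/eqP; rewrite eqEsubset sE.
apply/subsetP=> i iE; rewrite inE !permM !permE /=.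
have : (blk E (y (pt i)) < blk E (y (nx i)))%N by rewrite !yE blk_nx iE.
by move/blk_lt => h; rewrite !subSS ltn_sub2l // (leq_trans h) // -ltnS.
Qed.

(** The colouring names the coset of [s] under right multiplication by the Young subgroup of [G], so
    [cols G] indexes these cosets. Colours live in ['I_m.+1] only to have a fixed finite type; just
    the first [#|G|.+1] of them occur. *)
Definition colour G s : {ffun 'I_m.+1 -> 'I_m.+1} := [ffun x => Ordinal (blk_bound G (s x))].
Definition cols G := [set colour G s | s : 'S_m.+1].
Definition asc (v : {ffun 'I_m.+1 -> 'I_m.+1}) : {set 'I_m} := [set i | v (pt i) != v (nx i)].
Definition winc E (v : {ffun 'I_m.+1 -> 'I_m.+1}) :=
  [forall i, (i \in E) || (v (pt i) <= v (nx i))%N].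

Lemma colourE G s x : colour G s x = blk G (s x) :> nat.
Proof. by rewrite ffunE. Qed.

Lemma colour_eqE G s x y : (colour G s x == colour G s y) = (blk G (s x) == blk G (s y)).
Proof. by rewrite -(inj_eq val_inj) /= !colourE. Qed.

(** For adjacent points with different colours the order of their images under [s] is that of the
    colours; with equal colours it is their order under [s * t]. So the condition on [s] is read off
    from its colouring and the product alone. *)
Lemma des_factor E G s t : des t \subset G ->
  (des s \subset E) =
    winc E (colour G s) && (des (s * t)%g \subset E :|: asc (colour G s)).
Proof.
move=> /des_subP tG; apply/subsetP/andP => [sE | [/forallP wE /subsetP stE] i ides].
  have lts i : i \notin E -> (s (pt i) < s (nx i))%N.
    by rewrite -desPn; apply: contra; apply: sE.
  split.
    apply/forallP=> i; case: (boolP (i \in E)) => //= /lts/ltnW/(blk_le G).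
    by rewrite !colourE.
  apply/subsetP=> i; apply: contraLR; rewrite !inE negb_or negbK => /andP[/lts lt].
  by rewrite colour_eqE -leqNgt !permM => /eqP/(tG _ _ lt)/ltnW.
have lt : (s (nx i) < s (pt i))%N by move: ides; rewrite inE.
apply: contraT => iE; have := wE i; rewrite (negPf iE) !colourE /= => le.
have eb : blk G (s (nx i)) = blk G (s (pt i)) by apply/anti_leq; rewrite le blk_le // ltnW.
have : i \in des (s * t)%g by rewrite inE !permM tG.
by move/stE; rewrite !inE (negPf iE) colour_eqE eb eqxx.
Qed.

Variable F : fieldType.
Definition XI E : galg F m.+1 := [ffun s => (des s \subset E)%:R].

(* Solomon's multiplication rule: for fixed t the factorisations t = s * (s^-1 * t)
   counted by the product are determined by the colouring of s. *)
Lemma XI_mul E G :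
  XI E * XI G = \sum_(v in cols G | winc E v) XI (E :|: asc v).
Proof.
apply/ffunP=> t; rewrite galg_mulE sum_ffunE.
rewrite (partition_big (colour G) (mem (cols G))) /=; last first.
  by move=> s _; apply: imset_f.
rewrite [RHS]big_mkcondr /=; apply: eq_bigr => v /imsetP[s0 _ ->].
have [y yG dG] := young_coset_ex G (s0^-1 * t)%g.
(* The only factor with the colouring of [s0] for which [s^-1 * t] has its descents in [G]. *)
pose s1 := (s0 * y^-1)%g.
have y'G : young_set G y^-1%g by move=> x; rewrite -[in RHS](permKV y x) yG.
have cs1 : colour G s1 = colour G s0.
  by apply/ffunP=> x; apply: val_inj; rewrite /= !colourE permM y'G.
have ds1 : des (s1^-1 * t)%g \subset G by rewrite /s1 invMg invgK -mulgA.
rewrite (bigD1 s1) ?cs1 //= big1 ?addr0 => [|s /andP[/eqP cs ns]].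
  rewrite !ffunE ds1 mulr1 (des_factor E s1 ds1) mulKVg cs1.
  by case: winc => //=; rewrite ffunE.
rewrite !ffunE; case: (boolP (des (s^-1 * t)%g \subset G)) => ds; last by rewrite mulr0.
case/negP: ns; apply/eqP.
have sE : (s^-1 * s1 = 1)%g.
  apply: (@young_coset_uniq G _ (s1^-1 * t)%g) => //; last by rewrite mulgA mulgK.
  move=> x; rewrite permM -[RHS](congr1 (blk G) (permKV s x)).
  by rewrite -!colourE cs cs1.
by apply/eqP; rewrite eq_mulVg1 sE.
Qed.

End Blocks.

(** * Refinement up to rearrangement *)

Section WeakRefinement.
Variable m : nat.
Implicit Types (E G H : {set 'I_m}).

(** Weak refinement of the corresponding compositions: one permutation of the points carries each
    block of [E] into a block of [G]. In this form transitivity is composition of permutations. *)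
Definition WR E G := [exists s : 'S_m.+1, forall x, forall y,
  (blk E x == blk E y) ==> (blk G (s x) == blk G (s y))].

Lemma WRP E G : reflect (exists s : 'S_m.+1, forall x y,
  blk E x = blk E y -> blk G (s x) = blk G (s y)) (WR E G).
Proof.
apply: (iffP existsP) => -[s hs]; exists s.
  by move=> x y /eqP e; apply/eqP; move/forallP/(_ x)/forallP/(_ y)/implyP: hs; apply.
by apply/forallP=> x; apply/forallP=> y; apply/implyP=> /eqP/hs ->.
Qed.

Lemma WR_trans E G H : WR E G -> WR G H -> WR E H.
Proof.
move=> /WRP[s hs] /WRP[t ht]; apply/WRP; exists (s * t)%g => x y /hs/ht.
by rewrite !permM.
Qed.

Lemma WR_sub E G : G \subset E -> WR E G.
Proof.
move=> /subsetP sGE; apply/WRP; exists 1%g => x y; rewrite !perm1.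
apply: (@blk_const _ _ _ (blk G)) => i iE; rewrite blk_nx.
by case: (boolP (i \in G)) => [/sGE|//]; rewrite (negPf iE).
Qed.

(** A colouring constant on the blocks of [E] comes from a permutation that carries each of these
    blocks into a block of [G]. *)
Lemma WR_cols E G v : v \in cols G -> asc v \subset E -> WR E G.
Proof.
case/imsetP=> s _ -> /subsetP sE; apply/WRP; exists s => x y.
apply: (@blk_const _ _ _ (fun x => blk G (s x))) => i iE.
apply/eqP; rewrite -colour_eqE; apply: contraNT iE => h.
by apply: sE; rewrite inE.
Qed.

(** Counts the colourings constant on the blocks of [E]; this is the value of the Young permutation
    character of [G] at a permutation whose cycles are those blocks. *)
Definition phi G E := #|[set v in cols G | asc v \subset E]|.

Lemma phi_WR G E : phi G E != 0%N -> WR E G.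
Proof.
by rewrite cards_eq0 => /set0Pn[v]; rewrite inE => /andP[]; apply: WR_cols.
Qed.

End WeakRefinement.

(** * The descent algebra and its characters *)

Section DescentAlgebra.
Variables (F : fieldType) (m : nat).
Local Notation A := (galg F m.+1).
Local Notation XI := (@XI m F).
Implicit Types (E G H w : {set 'I_m}) (x y z : A) (P Q : pred {set 'I_m}).

(** One predicate serves for the descent algebra, the triangular filtration and the ideals of finer
    elements. *)
Definition inspan P x := exists a : {set 'I_m} -> F, x = \sum_(E | P E) a E *: XI E.

Lemma inspan0 P : inspan P 0.
Proof. by exists (fun=> 0); rewrite big1 // => E _; rewrite scale0r. Qed.

Lemma inspanD P x y : inspan P x -> inspan P y -> inspan P (x + y).
Proof.
move=> [a ->] [b ->]; exists (fun E => a E + b E); rewrite -big_split /=.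
by apply: eq_bigr => E _; rewrite scalerDl.
Qed.

Lemma inspanZ P c x : inspan P x -> inspan P (c *: x).
Proof.
move=> [a ->]; exists (fun E => c * a E); rewrite scaler_sumr.
by apply: eq_bigr => E _; rewrite scalerA.
Qed.

Lemma inspanN P x : inspan P x -> inspan P (- x).
Proof. by rewrite -scaleN1r; apply: inspanZ. Qed.

Lemma inspanB P x y : inspan P x -> inspan P y -> inspan P (x - y).
Proof. by move=> Px Py; apply: inspanD => //; apply: inspanN. Qed.

Lemma inspan_sum P I (r : seq I) (Q : pred I) (f : I -> A) :
  (forall i, Q i -> inspan P (f i)) -> inspan P (\sum_(i <- r | Q i) f i).
Proof.
move=> h; elim/big_ind: _ => //; [exact: inspan0|exact: inspanD].
Qed.

Lemma inspan_XI P E : P E -> inspan P (XI E).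
Proof.
move=> PE; exists (fun G => (G == E)%:R); rewrite (bigD1 E) //= eqxx scale1r big1 ?addr0 //.
by move=> G /andP[_ /negPf ->]; rewrite scale0r.
Qed.

Lemma inspan_sub P Q x : {subset P <= Q} -> inspan P x -> inspan Q x.
Proof.
move=> sPQ [a ->]; apply: inspan_sum => E PE; apply: inspanZ; apply: inspan_XI.
exact: sPQ.
Qed.

(** Containment of [E] is kept for triangularity, the weak refinements of both factors for the
    two-sided ideals [low]. *)
Lemma XI_mul_span E G :
  inspan [pred w : {set 'I_m} | [&& E \subset w, WR w E & WR w G]] (XI E * XI G).
Proof.
rewrite XI_mul; apply: inspan_sum => v /andP[vG _]; apply: inspan_XI => /=.
rewrite subsetUl WR_sub ?subsetUl //=; apply: WR_cols vG _; exact: subsetUr.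
Qed.

Lemma inspan_mul P Q (R : pred {set 'I_m}) x y : inspan P x -> inspan Q y ->
  (forall E G w, P E -> Q G -> E \subset w -> WR w E -> WR w G -> R w) ->
  inspan R (x * y).
Proof.
move=> [a ->] [b ->] h; rewrite mulr_suml; apply: inspan_sum => E PE.
rewrite mulr_sumr; apply: inspan_sum => G QG.
rewrite -scalerAl -scalerAr; do 2!apply: inspanZ.
by apply: inspan_sub (XI_mul_span E G) => w /and3P[s1 s2 s3]; apply: h s1 s2 s3.
Qed.

Definition inD := inspan predT.

Lemma inspan_inD P x : inspan P x -> inD x.
Proof. exact: inspan_sub. Qed.

Lemma inD_mul x y : inD x -> inD y -> inD (x * y).
Proof. by move=> Dx Dy; apply: inspan_mul Dx Dy _. Qed.

Lemma XI0 : XI set0 = 1 :> A.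
Proof.
apply/ffunP=> s; rewrite !ffunE; congr (nat_of_bool _)%:R.
apply/idP/eqP => [/des_subP h|->].
  apply: perm_mono_id => x y lt; apply: h lt _; rewrite /blk.
  by rewrite !(eq_card0 (A := [set _ in _ | _])) // => i; rewrite !inE.
by apply/des_subP=> x y lt _; rewrite !perm1.
Qed.

Lemma inD1 : inD 1. Proof. by rewrite -XI0; apply: inspan_XI. Qed.

Lemma inD_exp x k : inD x -> inD (x ^+ k).
Proof.
by move=> Dx; elim: k => [|k IH]; [apply: inD1|rewrite exprS; apply: inD_mul].
Qed.

(** Elements of the descent algebra are constant on descent classes, so their values at one
    representative of each class suffice. By [des_ex] the default is never taken. *)
Definition tau E : 'S_m.+1 := odflt 1%g [pick s | des s == E].

Lemma des_tau E : des (tau E) = E.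
Proof.
rewrite /tau; case: pickP => [s /eqP //|h].
by have [s se] := des_ex E; have := h s; rewrite se eqxx.
Qed.

(* Möbius inversion in the Boolean lattice of descent sets. *)
Definition xcoef E x := \sum_(G : {set 'I_m} | E \subset G) (-1) ^+ #|G :\: E| * x (tau G).

Lemma xcoefD E x y : xcoef E (x + y) = xcoef E x + xcoef E y.
Proof.
by rewrite -big_split /=; apply: eq_bigr => G _; rewrite ffunE mulrDr.
Qed.

Lemma xcoefZ E c x : xcoef E (c *: x) = c * xcoef E x.
Proof.
by rewrite mulr_sumr; apply: eq_bigr => G _; rewrite galgZE mulrCA.
Qed.

Lemma xcoef0 E : xcoef E 0 = 0.
Proof. by rewrite -(scale0r (0 : A)) xcoefZ mul0r. Qed.

Lemma xcoefB E x y : xcoef E (x - y) = xcoef E x - xcoef E y.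
Proof. by rewrite xcoefD -scaleN1r xcoefZ mulN1r. Qed.

Lemma xcoef_sum E I (r : seq I) (Q : pred I) (f : I -> A) :
  xcoef E (\sum_(i <- r | Q i) f i) = \sum_(i <- r | Q i) xcoef E (f i).
Proof. by apply: (big_morph _ (xcoefD E) (xcoef0 E)). Qed.

(** The coefficient is an alternating sum over the sets between [E] and [H]; toggling a point [d] of
    [H] outside [E] cancels it unless the two sets agree. *)
Lemma xcoef_XI E H : xcoef E (XI H) = (E == H)%:R.
Proof.
rewrite /xcoef (eq_bigr (fun G => if G \subset H then (-1) ^+ #|G :\: E| else 0)); last first.
  by move=> G _; rewrite ffunE des_tau; case: ifP; rewrite ?mulr1 ?mulr0.
rewrite -big_mkcondr /=; case: (eqVneq E H) => [->|neEH].
  rewrite (bigD1 H) ?subxx //= setDv cards0 big1 ?addr0 // => G /andP[/andP[s1 s2]].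
  by rewrite eqEsubset s1 s2.
case: (boolP (E \subset H)) => sEH; last first.
  by rewrite big_pred0 // => G; apply: contraNF sEH => /andP[]; apply: subset_trans.
have : E \proper H by rewrite properEneq neEH.
case/properP=> _ [d dH dE]; rewrite (bigID (fun G => d \in G)) /=.
rewrite (reindex_onto (setU [set d]) (fun G => G :\ d)) /=; last first.
  by move=> G /andP[_ dG]; rewrite setD1K.
rewrite addrC -[X in X + _]opprK -sumrN addrC.
rewrite [X in X - _](eq_bigl (fun G => (E \subset G) && (G \subset H) && (d \notin G))); last first.
  move=> G; rewrite setU11 andbT subUset sub1set dH /=.
  case: (boolP (d \in G)) => dG; rewrite ?andbF ?andbT.
    by apply/negP=> /andP[_ /eqP/setP/(_ d)]; rewrite !inE eqxx dG.
  rewrite setU1K // eqxx andbT; congr (_ && _).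
  apply/idP/idP=> [/subsetP s|/subset_trans->//]; last exact: subsetUr.
  apply/subsetP=> e eE; have := s e eE; rewrite !inE => /orP[/eqP ed|//].
  by rewrite ed (negPf dE) in eE.
apply/eqP; rewrite subr_eq0; apply/eqP/eq_bigr => G /andP[_ dG].
rewrite setDUl [in X in _ ^+ X](_ : [set d] :\: E = [set d]); last first.
  by apply/setP=> e; rewrite !inE; case: eqP => [->|]; rewrite ?dE ?andbF.
by rewrite cardsU1 !inE (negPf dG) andbF /= exprS mulN1r.
Qed.

Lemma xcoef_span0 P E x : inspan P x -> ~~ P E -> xcoef E x = 0.
Proof.
move=> [a ->] nPE; rewrite xcoef_sum big1 // => G PG; rewrite xcoefZ xcoef_XI.
by case: eqP nPE PG => [->/negPf->//|]; rewrite mulr0.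
Qed.

Lemma inD_coef x : inD x -> x = \sum_E xcoef E x *: XI E.
Proof.
move=> [a xE]; rewrite {1}xE; apply: eq_bigr => E _; congr (_ *: _); rewrite xE.
rewrite xcoef_sum (bigD1 E) //= xcoefZ xcoef_XI eqxx mulr1 big1 ?addr0 // => G /negPf nG.
by rewrite xcoefZ xcoef_XI eq_sym nG mulr0.
Qed.

Definition chi E x := xcoef E (XI E * x).

Lemma chiD E x y : chi E (x + y) = chi E x + chi E y.
Proof. by rewrite /chi mulrDr xcoefD. Qed.
Lemma chiZ E c x : chi E (c *: x) = c * chi E x.
Proof. by rewrite /chi -scalerAr xcoefZ. Qed.
Lemma chiB E x y : chi E (x - y) = chi E x - chi E y.
Proof. by rewrite /chi mulrBr xcoefB. Qed.
Lemma chi_sum E I (r : seq I) (Q : pred I) (f : I -> A) :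
  chi E (\sum_(i <- r | Q i) f i) = \sum_(i <- r | Q i) chi E (f i).
Proof. by rewrite /chi mulr_sumr xcoef_sum. Qed.
Lemma chi1 E : chi E 1 = 1.
Proof. by rewrite /chi mulr1 xcoef_XI eqxx. Qed.

Lemma asc_winc E (v : {ffun 'I_m.+1 -> 'I_m.+1}) : asc v \subset E -> winc E v.
Proof.
move=> /subsetP s; apply/forallP=> i; case: (boolP (i \in E)) => //= iE.
have: i \notin asc v by apply: contra iE => /s.
by rewrite inE negbK => /eqP ->.
Qed.

(** A term of Solomon's rule contributes to the coefficient of [XI E] exactly when [asc v] lies in
    [E], and then [winc E v] is automatic. *)
Lemma chi_XI E G : chi E (XI G) = (phi G E)%:R.
Proof.
rewrite /chi XI_mul xcoef_sum (eq_bigr (fun v => (asc v \subset E)%:R)); last first.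
  by move=> v _; rewrite xcoef_XI eq_sym; congr (nat_of_bool _)%:R; apply/eqP/setUidPl.
rewrite -natr_sum; congr (_%:R); rewrite /phi -sum1_card big_mkcond [RHS]big_mkcond /=.
apply: eq_bigr => v _; rewrite inE; case: (v \in cols G) => //=.
by case: (boolP (asc v \subset E)) => [/asc_winc -> //|]; case: ifP.
Qed.

Lemma XI_mulr E x : inD x -> inspan [pred w : {set 'I_m} | E \proper w] (XI E * x - chi E x *: XI E).
Proof.
move=> Dx; pose P := [pred w : {set 'I_m} | E \subset w].
have [a xE] : inspan P (XI E * x).
  have XE : inspan (pred1 E) (XI E) by apply: inspan_XI; rewrite /= eqxx.
  by apply: inspan_mul XE Dx _ => G H w /eqP -> _ ? _ _.
have -> : chi E x = a E.
  rewrite /chi xE xcoef_sum (bigD1 E) /= ?subxx // xcoefZ xcoef_XI eqxx mulr1.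
  by rewrite big1 ?addr0 // => G /andP[_ /negPf nG]; rewrite xcoefZ xcoef_XI eq_sym nG mulr0.
rewrite xE (bigD1 E) /= ?subxx // addrAC subrr add0r.
apply: inspan_sum => G /andP[sEG nGE]; apply: inspanZ; apply: inspan_XI => /=.
by rewrite properEneq eq_sym nGE.
Qed.

(** Modulo the span of the [XI w] with [w] properly containing [E], which is stable under right
    multiplication, [XI E] is an eigenvector with eigenvalue [chi E x]. *)
Lemma chiM E x y : inD x -> inD y -> chi E (x * y) = chi E x * chi E y.
Proof.
move=> Dx Dy; rewrite {1}/chi mulrA.
rewrite -[XI E * x](subrK (chi E x *: XI E)) mulrDl xcoefD.
rewrite (xcoef_span0 (P := [pred w : {set 'I_m} | E \proper w])) ?add0r ?inE ?properxx //.
  by rewrite -scalerAl xcoefZ.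
apply: inspan_mul (XI_mulr E Dx) Dy _ => G H w pEG _ sGw _ _.
exact: proper_sub_trans pEG sGw.
Qed.

Lemma chiX E x k : inD x -> chi E (x ^+ k) = chi E x ^+ k.
Proof.
move=> Dx; elim: k => [|k IH]; first by rewrite !expr0 chi1.
by rewrite !exprS chiM ?IH //; apply: inD_exp.
Qed.

Lemma chi_coef E x : inD x -> chi E x = \sum_G xcoef G x * (phi G E)%:R.
Proof.
by move=> Dx; rewrite {1}(inD_coef Dx) chi_sum; apply: eq_bigr => G _; rewrite chiZ chi_XI.
Qed.

(** With zero diagonal, each right multiplication moves [XI E] to strictly larger sets, and subsets
    of ['I_m] have at most [m] elements. *)
Lemma chi_nil x : inD x -> (forall E, chi E x = 0) -> x ^+ m.+1 = 0.
Proof.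
move=> Dx chi0.
have key k : inspan [pred w : {set 'I_m} | k <= #|w|]%N (x ^+ k).
  elim: k => [|k [a xk]]; first by rewrite expr0 -XI0; apply: inspan_XI.
  rewrite exprSr xk mulr_suml; apply: inspan_sum => E /= kE.
  rewrite -scalerAl; apply: inspanZ.
  have := XI_mulr E Dx; rewrite chi0 scale0r subr0; apply: inspan_sub => w /= pEw.
  exact: leq_ltn_trans kE (proper_card pEw).
have [a ->] := key m.+1; rewrite big_pred0 // => w /=.
by rewrite ltnNge (leq_trans (max_card _)) ?card_ord.
Qed.

End DescentAlgebra.

(** * Compositions as sets of breaks *)

Local Notation pos := (all (fun x => 0 < x)%N).

Lemma comps_aux_mem f k q : (k <= f)%N -> (q \in comps_aux f k) = is_comp k q.
Proof.
have nil0 q' : (q' \in [:: [::]]) = is_comp 0 q'.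
  by rewrite inE /is_comp; case: q' => [|[|a] q'] //=; rewrite andbF.
elim: f k q => [|f IH] k q; first by rewrite leqn0 => /eqP->; rewrite nil0.
rewrite /=; case: eqVneq => [->|k0] lekf; first by rewrite nil0.
apply/flatten_mapP/idP => [[a]|].
  rewrite mem_iota add1n ltnS => /andP[a0 ak] /mapP[q' + ->].
  rewrite IH; last by rewrite leq_subLR (leq_trans lekf) // -add1n leq_add2r.
  case/andP=> pq /eqP sq; apply/andP; split; first by rewrite /= a0.
  by rewrite /= sq subnKC.
case/andP; case: q => [_ /= /eqP k0'|a q /andP[a0 pq] /eqP sq]; first by rewrite -k0' in k0.
have ak : (a <= k)%N by rewrite -sq /= leq_addr.
exists a; first by rewrite mem_iota a0 add1n ltnS.
apply/mapP; exists q => //; rewrite IH; last first.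
  by rewrite leq_subLR (leq_trans lekf) // -add1n leq_add2r.
by apply/andP; split; [exact: pq | rewrite -sq /= addKn].
Qed.

Lemma mem_compositions n q : (q \in compositions n) = is_comp n q.
Proof. exact: comps_aux_mem. Qed.

Lemma compositions_uniq n : uniq (compositions n).
Proof.
suff: forall f k, uniq (comps_aux f k) by apply.
elim=> [|f IH] k /=; first by case: ifP.
case: ifP => // _; elim: (iota 1 k) (iota_uniq 1 k) => //= a r IHr /andP[ar ur].
rewrite cat_uniq IHr // andbT map_inj_uniq ?IH => [|x y [//]].
apply/hasPn=> q /flatten_mapP[b br /mapP[q' _ ->]]; apply/negP => /mapP[q'' _ [eb _]].
by rewrite -eb br in ar.
Qed.

Lemma psums_cons a q : psums (a :: q) = a :: map (addn a) (psums q).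
Proof.
rewrite /psums /= take0 addn0; congr (_ :: _).
by rewrite (iotaDl 1 1) -!map_comp; apply: eq_map => j /=.
Qed.

(** This is [block] with its argument in all of [nat], so that removing the first part of [q] can
    shift the point. *)
Definition nblk q x := count (fun t => t <= x)%N (psums q).

Lemma nblk_cons a q x :
  nblk (a :: q) x = if (a <= x)%N then (nblk q (x - a)).+1 else 0%N.
Proof.
rewrite /nblk psums_cons /= count_map; case: leqP => h.
  rewrite add1n; congr _.+1; apply: eq_count => t /=.
  by rewrite -leq_subRL.
rewrite add0n -(count_pred0 (psums q)); apply: eq_count => t /=.
by rewrite leqNgt (leq_trans h) // leq_addr.
Qed.

Lemma psums_gt0 q t : pos q -> t \in psums q -> (0 < t)%N.
Proof.
elim: q t => // a q IH t /= /andP[a0 pq]; rewrite psums_cons inE => /orP[/eqP->//|].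
by case/mapP=> u _ ->; rewrite addn_gt0 a0.
Qed.

Lemma psums_uniq q : pos q -> uniq (psums q).
Proof.
elim: q => // a q IH /andP[a0 pq]; rewrite psums_cons /= map_inj_uniq ?IH ?andbT //.
  apply/mapP=> -[t /(psums_gt0 pq) t0 e].
  by move: t0; rewrite -(ltn_add2l a) addn0 -e ltnn.
exact: addnI.
Qed.

Lemma nblk0 q : pos q -> nblk q 0 = 0%N.
Proof.
move=> pq; apply/eqP; rewrite -leqn0 leqNgt -has_count; apply/hasPn=> t /(psums_gt0 pq).
by rewrite -ltnNge.
Qed.

Lemma nblkS q x : pos q -> nblk q x.+1 = ((x.+1 \in psums q) + nblk q x)%N.
Proof.
move=> pq; rewrite /nblk -(count_uniq_mem _ (psums_uniq pq)) -count_predUI.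
rewrite [X in (_ + X)%N](_ : _ = 0%N) ?addn0; last first.
  apply/eqP; rewrite -leqn0 leqNgt -has_count; apply/hasPn=> t _ /=.
  by apply/negP => /andP[/eqP->]; rewrite ltnn.
by apply: eq_count => t /=; rewrite leq_eqVlt ltnS.
Qed.

Lemma nblk_last q : pos q -> nblk q (sumn q).-1 = (size q).-1.
Proof.
elim: q => // a [|b q] IH /andP[a0 pq]; first by rewrite nblk_cons /= addn0 -ltnS prednK // ltnn.
have s0 : (0 < sumn (b :: q))%N by case/andP: pq => b0 _; rewrite addn_gt0 b0.
rewrite nblk_cons -[sumn (a :: _)]/(a + sumn (b :: q))%N -(prednK s0) addnS /=.
by rewrite leq_addr addKn -[(b + sumn q)%N]/(sumn (b :: q)) IH.
Qed.

Lemma count_nblk q j : pos q ->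
  count (fun x => nblk q x == j) (iota 0 (sumn q)) = nth 0%N q j.
Proof.
elim: q j => [|a q IH] j; first by rewrite nth_nil.
case/andP=> a0 pq; rewrite [sumn _]/= iotaD count_cat add0n.
rewrite (_ : count _ (iota 0 a) = if j == 0%N then a else 0%N); last first.
  rewrite (eq_in_count (a2 := fun=> 0%N == j)); last first.
    by move=> x; rewrite mem_iota add0n nblk_cons => /andP[_]; rewrite ltnNge => /negPf ->.
  by rewrite eq_sym; case: eqP => _; rewrite ?count_predT ?count_pred0 ?size_iota.
rewrite -[X in iota X (sumn q)]addn0 iotaDl count_map.
rewrite (eq_count (a2 := fun x => (nblk q x).+1 == j)); last first.
  by move=> x /=; rewrite nblk_cons leq_addr addKn.
case: j => [|j] /=; last by rewrite add0n -IH.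
by rewrite (eq_count (a2 := pred0)) ?count_pred0 ?addn0.
Qed.

Lemma card_ord_count n (P : pred nat) : #|[set x : 'I_n | P x]| = count P (iota 0 n).
Proof.
rewrite -sum1_card -sum1_count -[n in iota 0 n]subn0 -/(index_iota 0 n) big_mkord.
by apply: eq_bigl => x; rewrite inE.
Qed.

Lemma card_ord_lt n k : (k <= n)%N -> #|[set x : 'I_n | (x < k)%N]| = k.
Proof.
move=> lekn; rewrite (card_ord_count n (fun x => x < k)%N) -(subnKC lekn) iotaD count_cat.
rewrite (eq_in_count (a2 := predT)) => [|x]; last by rewrite mem_iota add0n => /andP[_ ->].
rewrite count_predT size_iota add0n (eq_in_count (a2 := pred0)) ?count_pred0 ?addn0 // => x.
by rewrite mem_iota => /andP[h _]; rewrite ltnNge h.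
Qed.

Section Breaks.
Variable m : nat.
Implicit Types (E G : {set 'I_m}) (q : seq nat) (x : 'I_m.+1).

(** The element [i] of ['I_m] stands for the partial sum [i.+1]; the last partial sum, equal to
    [m.+1], imposes no condition and is dropped. *)
Definition Dset q : {set 'I_m} := [set i : 'I_m | i.+1 \in psums q].
Definition comp_of E : seq nat :=
  [seq #|[set x : 'I_m.+1 | blk E x == j]| | j <- iota 0 #|E|.+1].

Lemma blk_ord0 E : blk E ord0 = 0%N.
Proof. by apply: eq_card0 => i; rewrite !inE ltn0 andbF. Qed.

Lemma blk_max E : blk E ord_max = #|E|.
Proof. by apply: eq_card => i; rewrite !inE ltn_ord andbT. Qed.

Lemma nx_case x : x = ord0 \/ exists i, x = nx i.
Proof.
case: x => -[|k] lk; first by left; apply: val_inj.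
by right; exists (Ordinal (lk : (k < m)%N)); apply: val_inj.
Qed.

Lemma blkE q x : pos q -> nblk q x = blk (Dset q) x.
Proof.
move=> pq; case: x => k; elim: k => [|k IH] lk.
  have -> : Ordinal lk = ord0 by apply: val_inj.
  by rewrite blk_ord0 /= nblk0.
set i := Ordinal (lk : (k < m)%N).
have -> : Ordinal lk = nx i by apply: val_inj.
rewrite blk_nx inE nblkS //; congr (_ + _)%N.
by have := IH (ltnW lk); rewrite /= => ->; congr blk; apply: val_inj.
Qed.

Lemma blk_size q : is_comp m.+1 q -> size q = #|Dset q|.+1.
Proof.
case/andP=> pq /eqP sq; rewrite -blk_max -blkE //=.
by have := nblk_last pq; rewrite sq /= => ->; rewrite prednK //; case: q pq sq.
Qed.

Lemma blk_fiber q j : is_comp m.+1 q ->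
  #|[set x : 'I_m.+1 | blk (Dset q) x == j]| = nth 0%N q j.
Proof.
case/andP=> pq /eqP sq; rewrite -count_nblk // sq -card_ord_count.
by apply: eq_card => x; rewrite !inE blkE.
Qed.

Lemma Dset_K q : is_comp m.+1 q -> comp_of (Dset q) = q.
Proof.
move=> cq; apply: (@eq_from_nth _ 0%N); rewrite size_map size_iota ?blk_size // => j lj.
by rewrite (nth_map 0%N) ?size_iota // nth_iota // add0n blk_fiber.
Qed.

(** The block number grows by at most one from a point to the next, so the first point with number
    at least [j] has number [j]. *)
Lemma blk_surj E j : (j <= #|E|)%N -> exists x, blk E x = j.
Proof.
move=> lej; pose P x := (j <= blk E x)%N.
have Pm : P ord_max by rewrite /P blk_max.
case: (@arg_minnP _ ord_max P (fun x => val x) Pm) => x Px min_x; exists x.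
case: (nx_case x) => [x0|[i xi]].
  by move: Px; rewrite /P x0 blk_ord0 leqn0 => /eqP.
apply/anti_leq; rewrite [X in _ && X]Px andbT.
have : ~~ P (pt i) by apply/negP=> /min_x; rewrite xi /= /bump /= add1n ltnn.
rewrite /P -ltnNge => h; rewrite xi blk_nx; case: (i \in E) => //=.
by rewrite add0n ltnW.
Qed.

Lemma blk_leE E x : (blk E x <= #|E|)%N.
Proof. by rewrite -blk_max blk_le // -ltnS. Qed.

Lemma sumn_take_comp E j : (j <= #|E|.+1)%N ->
  sumn (take j (comp_of E)) = #|[set x : 'I_m.+1 | (blk E x < j)%N]|.
Proof.
move=> lej; rewrite /comp_of -map_take take_iota (minn_idPl lej).
elim: j {lej} => [|j IH].
  by apply/esym/eq_card0 => x; rewrite !inE ltn0.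
rewrite -(addn1 j) iotaD map_cat sumn_cat /= addn0 IH add0n -cardsUI.
rewrite [X in (_ + X)%N](_ : _ = 0%N) ?addn0; last first.
  by apply: eq_card0 => x; rewrite !inE; case: (ltngtP (blk E x) j).
by apply: eq_card => x; rewrite !inE addn1 ltnS [RHS]leq_eqVlt orbC.
Qed.

Lemma comp_of_comp E : is_comp m.+1 (comp_of E).
Proof.
apply/andP; split.
  apply/allP=> k /mapP[j]; rewrite mem_iota add0n ltnS => /andP[_ /blk_surj[x xj]] ->.
  by apply/card_gt0P; exists x; rewrite inE xj.
have := sumn_take_comp (leqnn #|E|.+1); rewrite take_oversize ?size_map ?size_iota // => ->.
by rewrite -[X in _ == X]card_ord -cardsT; apply/eqP/eq_card => x; rewrite !inE ltnS blk_leE.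
Qed.

Lemma comp_of_K E : Dset (comp_of E) = E.
Proof.
have card_le (i : 'I_m) : #|[set x : 'I_m.+1 | (x <= i)%N]| = i.+1.
  by rewrite -(@card_ord_lt m.+1 i.+1) ?ltnS 1?ltnW //.
apply/setP=> i; rewrite inE; apply/mapP/idP => [[j]|iE].
  rewrite mem_iota size_map size_iota add1n !ltnS => /andP[j0 lej].
  rewrite sumn_take_comp // => e; apply: contraT => iE.
  have eb : blk E (nx i) = blk E (pt i) by rewrite blk_nx (negPf iE).
  (* The points [i] and [i.+1] share a block, so the first [j] blocks contain both or neither: at
     least [i.+2] or at most [i] points, never [i.+1]. *)
  case: (ltnP (blk E (pt i)) j) => h.
    have : (i.+2 <= i.+1)%N; last by rewrite ltnn.
    rewrite [X in (_ <= X)%N]e -(@card_ord_lt m.+1 i.+2) ?ltnS //.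
    apply/subset_leq_card/subsetP=> x; rewrite !inE ltnS => lex.
    by apply: leq_ltn_trans h; rewrite -eb; apply: blk_le.
  have : (#|[set x : 'I_m.+1 | (blk E x < j)%N]| <= #|[set x : 'I_m.+1 | (x < i)%N]|)%N.
    apply/subset_leq_card/subsetP=> x; rewrite !inE => ltx.
    by have := leq_trans ltx h; move/blk_lt.
  by rewrite -e card_ord_lt ?ltnn // ltnW // ltnS ltnW.
exists (blk E (nx i)).
  by rewrite mem_iota size_map size_iota add1n !ltnS blk_nx iE /= -add1n leq_add2l (leq_trans (blk_leE _ _)).
rewrite sumn_take_comp ?(leq_trans (blk_leE _ _)) // -card_le; apply: eq_card => x.
rewrite !inE; apply/idP/idP => [h|]; last first.
  by move/blk_lt; rewrite ltnS.
by rewrite blk_nx iE add1n ltnS; apply: blk_le.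
Qed.

Lemma sum_compositions (V : zmodType) (f : seq nat -> V) :
  \sum_(q <- compositions m.+1) f q = \sum_(E : {set 'I_m}) f (comp_of E).
Proof.
have -> : \sum_E f (comp_of E) = \sum_(q <- [seq comp_of E | E <- enum {set 'I_m}]) f q.
  by rewrite big_map big_enum.
apply: perm_big; apply: uniq_perm; first exact: compositions_uniq.
  by rewrite map_inj_uniq ?enum_uniq //; apply: can_inj comp_of_K.
move=> q; rewrite mem_compositions; apply/idP/mapP => [cq|[E _ ->]].
  by exists (Dset q); rewrite ?mem_enum // Dset_K.
exact: comp_of_comp.
Qed.

Lemma perm_flatten_filter (s : seq nat) (h : nat -> nat) l :
  perm_eq (flatten [seq [seq j <- s | h j == i] | i <- iota 0 l])
          [seq j <- s | (h j < l)%N].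
Proof.
apply/seq.permP=> a; elim: l => [|l IH].
  by rewrite /= count_filter (eq_count (a2 := pred0)) ?count_pred0 // => x /=; rewrite andbF.
rewrite -(addn1 l) iotaD map_cat flatten_cat count_cat IH /= cats0 add0n !count_filter.
rewrite -count_predUI [X in (_ + X)%N](_ : _ = 0%N) ?addn0.
  by apply: eq_count => x /=; rewrite addn1 ltnS [in RHS]leq_eqVlt orbC andb_orr.
apply/eqP; rewrite -leqn0 leqNgt -has_count; apply/hasPn=> x _ /=.
by case: (ltngtP (h x) l); rewrite ?andbF.
Qed.

(** The witness [s] assigns to each part of [q] the part [h] of [r] whose block receives it.
    Grouping the parts of [q] by [h] gives the rearrangement, and the sums are right because the
    preimage under [s] of a block of [r] is a union of blocks of [q]. *)
Lemma WR_weak_refines q r : is_comp m.+1 q -> is_comp m.+1 r ->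
  WR (Dset q) (Dset r) -> weak_refines q r.
Proof.
move=> cq cr /WRP[s hs].
pose h j := if [pick x | blk (Dset q) x == j] is Some x then blk (Dset r) (s x) else 0%N.
have hE x : h (blk (Dset q) x) = blk (Dset r) (s x).
  rewrite /h; case: pickP => [y /eqP/hs //|/(_ x)]; by rewrite eqxx.
have hlt j : (j < size q)%N -> (h j < size r)%N.
  rewrite (blk_size cq) ltnS => /blk_surj[x <-]; rewrite hE (blk_size cr) ltnS.
  exact: blk_leE.
pose js i := [seq j <- iota 0 (size q) | h j == i].
pose rs := [seq [seq nth 0%N q j | j <- js i] | i <- iota 0 (size r)].
exists (flatten rs); split.
  have -> : flatten rs = map (nth 0%N q) (flatten [seq js i | i <- iota 0 (size r)]).
    by rewrite map_flatten -map_comp.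
  rewrite -[X in perm_eq _ X](mkseq_nth 0%N q); apply: perm_map.
  apply: perm_trans (perm_flatten_filter _ _ _) _.
  rewrite (eq_in_filter (a2 := predT)) ?filter_predT // => j.
  by rewrite mem_iota add0n => /andP[_ /hlt].
exists rs; split => //.
  apply: (@eq_from_nth _ 0%N); rewrite !size_map size_iota // => i li.
  rewrite -map_comp (nth_map 0%N) ?size_iota // nth_iota // add0n /=.
  rewrite sumnE big_map big_filter -(blk_fiber i cr).
  rewrite -[X in iota 0 X]subn0 -/(index_iota 0 (size q)) big_mkord.
  rewrite -(card_imset _ (@perm_inj _ s^-1%g)) -sum1_card.
  have ltb x : (blk (Dset q) x < size q)%N by rewrite (blk_size cq) ltnS blk_leE.
  rewrite (partition_big (fun x => Ordinal (ltb x)) (fun j : 'I_(size q) => h j == i)) /=.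
    apply: eq_bigr => j /eqP hj; rewrite -(blk_fiber j cq) -sum1_card.
    apply: eq_bigl => x; rewrite !inE -[X in _ = _ && X](inj_eq val_inj) /=.
    case: eqP => [ej|]; rewrite ?andbF ?andbT //.
    apply/esym/imsetP; exists (s x); last by rewrite permK.
    by rewrite inE -hE ej hj.
  move=> x /imsetP[y]; rewrite inE => /eqP <- ->.
  by rewrite hE permKV.
apply/allP=> t /mapP[i _ ->]; apply/allP=> k /mapP[j]; rewrite mem_filter mem_iota.
case/and3P=> _ _ lj ->; case/andP: cq => /allP pq _; apply: pq; exact: mem_nth.
Qed.

(** A positive part needs at least one piece; if the total count of pieces equals the number of
    parts, every part consists of a single piece. *)
Lemma flatten_size_sumn (rs : seq (seq nat)) : pos (map sumn rs) ->
  (size rs <= size (flatten rs))%N /\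
  (size (flatten rs) = size rs -> flatten rs = map sumn rs).
Proof.
elim: rs => // t rs IH /= /andP[t0 /IH[le eqs]]; rewrite size_cat.
have st : (0 < size t)%N by case: t t0.
split; first by rewrite -add1n leq_add.
move=> e; have st1 : size t = 1%N.
  apply/anti_leq; rewrite st andbT -(leq_add2r (size rs)) add1n -e leq_add2l.
  exact: le.
move: e; rewrite st1 add1n => -[/eqs ->].
by case: t st1 {t0 st} => [|a [|b t]] //= _; rewrite addn0.
Qed.

Lemma weak_refines_size q r : pos r -> weak_refines q r ->
  (size r <= size q)%N /\ (size q = size r -> perm_eq q r).
Proof.
move=> pr [q' [pq' [rs [rsr _ fq']]]]; subst r q'.
have [le eqs] := flatten_size_sumn pr.
rewrite -(perm_size pq') size_map; split=> // /eqs <-.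
by rewrite perm_sym.
Qed.

Lemma WR_card q r : is_comp m.+1 q -> is_comp m.+1 r -> WR (Dset q) (Dset r) ->
  (size r <= size q)%N /\ (size q = size r -> perm_eq q r).
Proof.
move=> cq cr w; apply: weak_refines_size; first by case/andP: cr.
exact: WR_weak_refines.
Qed.

Lemma Xi_XI (F : fieldType) q : Xi F m.+1 q = XI F (Dset q).
Proof.
apply/ffunP=> s; rewrite !ffunE; set b := [forall _, _]; set c := _ \subset _.
suff -> : b = c by case: c.
(* The break [i] has one-based position [i.+1], the value of [nx i]; position 0 is never a
   descent. *)
apply/forallP/subsetP => [h i ides | h i].
  have := h (nx i); rewrite inE /= => /implyP; apply.
  apply/existsP; exists (pt i); apply/existsP; exists (nx i).
  by rewrite !eqxx /=; move: ides; rewrite inE.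
apply/implyP=> /existsP[j /existsP[k /and3P[/eqP ji /eqP ki lt]]].
have jm : (j < m)%N by rewrite -ltnS ji ltn_ord.
have := h (Ordinal jm); rewrite !inE /= ji; apply.
suff [-> ->] : nx (Ordinal jm) = k /\ pt (Ordinal jm) = j by [].
by split; apply: val_inj => //=; rewrite ki -ji.
Qed.

End Breaks.
Arguments Dset {m} q.

(** * Permutation characters *)

Section FixedCosets.
Variables (gT : finGroupType) (R : {set {set gT}}).
Local Open Scope group_scope.
Hypothesis Rmul : forall C (g : gT), C \in R -> C :* g \in R.

Definition fixR (g : gT) := #|[set C in R | C :* g == C]|.

Lemma fixR_conj g k : fixR (g ^ k)%g = fixR g.
Proof.
rewrite /fixR -[RHS](card_imset _ (@rcoset_inj _ k)); apply: eq_card => C.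
apply/idP/imsetP => [|[D]].
  rewrite inE => /andP[CR /eqP fC]; exists (C :* k^-1)%g; last by rewrite rcosetKV.
  by rewrite inE Rmul //= -{2}fC -!rcosetM conjgE -!mulgA mulgV mulg1.
case/setIdP=> DR /eqP fD ->; rewrite inE Rmul //=.
by rewrite -!rcosetM conjgE !mulgA mulgV mul1g rcosetM fD.
Qed.

(** The [p]-part of [g] generates a [p]-group acting on the members of [R] fixed by the [p']-part.
    Its fixed points there are exactly those of [g], because both parts are powers of [g], and a
    [p]-group fixes as many points as there are modulo [p]. *)
Lemma fixR_constt p g : fixR g = fixR (g.`_p^')%g %[mod p].
Proof.
pose x := (g.`_p^')%g; pose u := (g.`_p)%g; pose S := [set C in R | C :* x == C].
have fixX (C : {set gT}) z k : C :* z = C -> C :* (z ^+ k)%g = C.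
  by move=> fz; elim: k => [|k IH]; rewrite ?expg0 ?rcoset1 // expgSr rcosetM IH.
have cux : commute u x by apply: commuteX2.
have aS : [acts <[u]>, on S | 'Rs].
  apply/actsP=> _ /cycleP[k ->] C; rewrite /= rcosetE.
  have cx : (u ^+ k * x = x * u ^+ k)%g by apply/commute_sym/commuteX/commute_sym.
  rewrite !inE; apply/andP/andP => -[CR /eqP fC]; split.
  - by have := Rmul (u ^+ k)^-1 CR; rewrite rcosetK.
  - apply/eqP/(@rcoset_inj _ (u ^+ k)%g); rewrite -rcosetM -cx rcosetM; exact: fC.
  - exact: Rmul.
  - by rewrite -rcosetM cx rcosetM fC.
have := pgroup_fix_mod (p_elt_constt p g) aS => h; apply/esym; rewrite /fixR -/x -/S h.
congr (_ %% p)%N; apply: eq_card => C; rewrite in_setI [C \in S]inE [RHS]inE.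
have gE : g = (u * x)%g by rewrite consttC.
apply/andP/andP => [[/andP[CR /eqP fx] /afixP fu]|[CR /eqP fg]]; split=> //.
  by rewrite gE rcosetM; have := fu u (cycle_id u); rewrite /= rcosetE => ->; rewrite fx.
- rewrite CR; apply/eqP; exact: fixX.
- by apply/afixP=> _ /cycleP[k ->]; rewrite /= rcosetE; do 2!apply: (fixX).
Qed.

End FixedCosets.

Section PermChar.
Variable m : nat.
Implicit Types (E G : {set 'I_m}) (g s t : 'S_m.+1).

Definition fixc G g := #|[set v in cols G | [forall x, v (g x) == v x]]|.

(** The inverse turns the cosets named by colourings into the right cosets on which the permutation
    character is defined. *)
Definition coset_of_col G (v : {ffun 'I_m.+1 -> 'I_m.+1}) : {set 'S_m.+1} :=
  [set t | colour G t^-1%g == v].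

Lemma colour_eq G s t : (forall x, blk G (s x) = blk G (t x)) -> colour G s = colour G t.
Proof. by move=> h; apply/ffunP=> x; apply: val_inj; rewrite /= !colourE. Qed.

Lemma young_rcoset q s : is_comp m.+1 q ->
  (young m.+1 q :* s)%g = coset_of_col (Dset q) (colour (Dset q) s^-1%g).
Proof.
case/andP=> pq _; apply/setP=> t; rewrite mem_rcoset !inE.
apply/forallP/eqP => [h|/ffunP h x].
  apply: colour_eq => x; have /eqP := h (t^-1%g x).
  by rewrite -[block _ _]/(nblk _ _) -[X in _ = X]/(nblk _ _) !blkE // permM permKV.
rewrite -[block _ _]/(nblk _ _) -[X in _ == X]/(nblk _ _) !blkE // permM.
by have := congr1 val (h (t x)); rewrite /= !colourE permK => ->.
Qed.

(** Through [coset_of_col], right translation by [g] becomes composition of colourings with a power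
    of [g], so fixed cosets are the [g]-invariant colourings. *)
Lemma fixR_fixc q g : is_comp m.+1 q ->
  fixR (rcosets (young m.+1 q) [set: 'S_m.+1]) g = fixc (Dset q) g.
Proof.
move=> cq; set G := Dset q.
have Kinj : {in cols G &, injective (coset_of_col G)}.
  move=> v w /imsetP[s _ ->] _ /setP/(_ s^-1%g); rewrite !inE invgK eqxx.
  by move/esym/eqP.
rewrite /fixc -(card_in_imset (f := coset_of_col G)); last first.
  by move=> v w; rewrite !inE => /andP[vG _] /andP[wG _]; apply: Kinj.
have fixK v : v \in cols G -> (coset_of_col G v :* g == coset_of_col G v)%g =
    [forall x, v (g x) == v x].
  move=> /imsetP[s _ ->]; apply/eqP/forallP => [/setP/(_ s^-1%g)|h].
    rewrite mem_rcoset !inE invgK eqxx => /eqP/ffunP h x.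
    apply/eqP/val_inj; rewrite /= colourE -h colourE.
    by rewrite invMg !invgK permM.
  apply/setP=> t; rewrite mem_rcoset !inE invMg invgK.
  apply/eqP/eqP => /ffunP e; apply/ffunP=> x.
    have := e (g^-1%g x); rewrite -(eqP (h (g^-1%g x))) permKV => <-.
    by apply: val_inj; rewrite /= !colourE permM permKV.
  by rewrite -(eqP (h x)) -e; apply: val_inj; rewrite /= !colourE permM.
apply: eq_card => C; apply/idP/imsetP => [|[v]].
  rewrite inE => /andP[/rcosetsP[s _ ->]]; rewrite young_rcoset // -/G => fC.
  exists (colour G s^-1%g) => //; rewrite inE imset_f //=.
  by rewrite -fixK // imset_f.
rewrite inE => /andP[vG]; rewrite -fixK // => fC ->; rewrite inE fC andbT.
case/imsetP: vG => s _ ->; apply/rcosetsP; exists s^-1%g; rewrite ?inE //.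
by rewrite young_rcoset // invgK.
Qed.

Lemma perm_charE (F : fieldType) q g : is_comp m.+1 q ->
  perm_char F m.+1 q g = (fixc (Dset q) g)%:R.
Proof. by move=> cq; rewrite ffunE -fixR_fixc. Qed.

Lemma rcosets_mul q (C : {set 'S_m.+1}) g :
  C \in rcosets (young m.+1 q) [set: 'S_m.+1] ->
  (C :* g)%g \in rcosets (young m.+1 q) [set: 'S_m.+1].
Proof.
case/rcosetsP=> s _ ->; apply/rcosetsP; exists (s * g)%g; rewrite ?inE //.
by rewrite rcosetM.
Qed.

Lemma fixc_conj G g k : fixc G (g ^ k)%g = fixc G g.
Proof.
rewrite -(comp_of_K G) -!fixR_fixc ?comp_of_comp //; apply: fixR_conj => C z.
exact: rcosets_mul.
Qed.

Lemma fixc_constt p G g : fixc G g = fixc G (g.`_p^')%g %[mod p].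
Proof.
rewrite -(comp_of_K G) -!fixR_fixc ?comp_of_comp //; apply: fixR_constt => C z.
exact: rcosets_mul.
Qed.

(* Among the permutations preserving the blocks take one with the fewest cycles: a
   transposition would merge two cycles lying in one block. *)
Lemma block_perm_ex E :
  exists h : 'S_m.+1, forall x, porbit h x = [set y | blk E y == blk E x].
Proof.
pose P h := [forall x, blk E ((h : 'S_m.+1) x) == blk E x].
have P1 : P 1%g by apply/forallP=> x; rewrite perm1.
case: (@arg_minnP _ 1%g P (fun h => #|porbits h|) P1) => h /forallP Ph min_h.
exists h => x; apply/setP=> y; rewrite inE; apply/idP/eqP => [/porbitP[k ->]|eb].
  elim: k => [|k IH]; first by rewrite expg0 perm1.
  by rewrite expgSr permM (eqP (Ph _)).
apply: contraT => yx; pose t := tperm x y.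
have Pt : P (t * h)%g.
  apply/forallP=> z; rewrite permM (eqP (Ph _)); apply/eqP.
  by rewrite /t; case: tpermP => [->|->|//].
have := min_h _ Pt; have := porbits_mul_tperm h x y; rewrite /= -/t.
have ne : x != y by apply: contraNneq yx => ->; rewrite porbit_id.
rewrite porbit_sym yx ne /= => e; rewrite leqNgt; case/negP.
by rewrite -(ltn_add2r 1) -e ltn_add2l.
Qed.

Definition bperm E : 'S_m.+1 :=
  odflt 1%g [pick h | [forall x, porbit h x == [set y | blk E y == blk E x]]].

Lemma porbit_bperm E x : porbit (bperm E) x = [set y | blk E y == blk E x].
Proof.
rewrite /bperm; case: pickP => [h /forallP/(_ x)/eqP //|nh].
have [h hE] := block_perm_ex E; have := nh h; case/negP.
by apply/forallP=> y; rewrite hE.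
Qed.

(** A colouring invariant under a permutation is one that is constant on its cycles, here the blocks
    of [E]. *)
Lemma fixc_bperm G E : fixc G (bperm E) = phi G E.
Proof.
apply: eq_card => v; rewrite !inE; congr (_ && _).
apply/forallP/subsetP => [h i|h x].
  rewrite inE; apply: contraR => iE.
  have : nx i \in porbit (bperm E) (pt i).
    by rewrite porbit_bperm inE blk_nx (negPf iE).
  case/porbitP=> k ->; elim: k => [|k IH]; first by rewrite expg0 perm1.
  by rewrite expgSr permM (eqP (h _)).
apply/eqP; apply: (blk_const (E := E)).
  move=> i iE; apply/eqP; apply: contraNT iE => ne; apply: h; by rewrite inE.
have := mem_porbit (bperm E) 1 x; rewrite expg1 porbit_bperm inE.
by move/eqP.
Qed.

Lemma cycle_type_bperm E : cycle_type (bperm E) = sort geq (comp_of E).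
Proof.
have geqT : total geq by move=> a b; apply: leq_total.
apply/perm_sortP => //; first by move=> b a c h1 h2; apply: leq_trans h2 h1.
  by move=> a b; rewrite andbC => /anti_leq.
have -> : comp_of E = [seq #|C| | C : {set 'I_m.+1} <-
    [seq [set x | blk E x == j] | j <- iota 0 #|E|.+1]].
  by rewrite -map_comp.
apply: perm_map; apply: uniq_perm; first exact: enum_uniq.
  rewrite map_inj_in_uniq ?iota_uniq // => j k; rewrite !mem_iota !add0n !ltnS.
  move=> /andP[_ /blk_surj[x xj]] _ /setP/(_ x); rewrite !inE xj eqxx.
  by move/esym/eqP.
move=> C; rewrite mem_enum; apply/imsetP/mapP => [[x _ ->]|[j]].
  exists (blk E x); last by rewrite porbit_bperm.
  by rewrite mem_iota add0n ltnS blk_leE.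
rewrite mem_iota add0n ltnS => /andP[_ /blk_surj[x <-]] ->.
by exists x => //; rewrite porbit_bperm.
Qed.

End PermChar.

(** * Cycle types and conjugacy *)

Section Conjugacy.
Variable n : nat.
Implicit Types (x y : 'S_n) (a b i : 'I_n).

Lemma iter_porbit_mod x a j : iter j x a = iter (j %% #|porbit x a|) x a.
Proof.
rewrite {1}(divn_eq j #|porbit x a|) addnC iterD; congr iter.
elim: (j %/ _)%N => // k IH; rewrite mulSn iterD IH; exact: iter_porbit.
Qed.

Lemma iter_porbit_inj x a j k : (iter j x a == iter k x a) = (j == k %[mod #|porbit x a|]).
Proof.
have L0 : (0 < #|porbit x a|)%N by rewrite lt0n card_porbit_neq0.
rewrite (iter_porbit_mod x a j) (iter_porbit_mod x a k).
have nthE l : iter (l %% #|porbit x a|) x a =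
    nth a (traject x a #|porbit x a|) (l %% #|porbit x a|) by rewrite nth_traject // ltn_mod.
by rewrite !nthE nth_uniq ?uniq_traject_porbit // size_traject ltn_mod.
Qed.

Lemma porbitsP x C : C \in porbits x -> exists a, C = porbit x a.
Proof. by case/imsetP=> a _ ->; exists a. Qed.

(** Match the cycles of [x] with cycles of [y] of the same length by [be], choose base points [a]
    and [b] in matched cycles, and send the [j]-th iterate of [a] to the [j]-th iterate of [b]. *)
Lemma cycle_type_conj x y : cycle_type x = cycle_type y -> exists k, y = (x ^ k)%g.
Proof.
set A := enum (porbits x); set B := enum (porbits y) => ct.
have pAB : perm_eq [seq #|C| | C : {set 'I_n} <- A] [seq #|C| | C : {set 'I_n} <- B].
  by rewrite -(perm_sort geq) perm_sym -(perm_sort geq) -[sort _ _]/(cycle_type y) -ct.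
have : exists be : {set 'I_n} -> {set 'I_n},
    [/\ {in A, forall C, be C \in B}, {in A &, injective be} & {in A, forall C, #|be C| = #|C|}].
  have [Is pIs AE] := perm_iotaP 0%N pAB; rewrite size_map in pIs.
  have szA : size Is = size A by have := congr1 size AE; rewrite !size_map.
  have IsB k : (k < size A)%N -> (nth 0%N Is k < size B)%N.
    by rewrite -szA => /(mem_nth 0%N); rewrite (perm_mem pIs) mem_iota add0n => /andP[].
  have iA C : C \in A -> (index C A < size A)%N by rewrite index_mem.
  exists (fun C => nth set0 B (nth 0%N Is (index C A))); split.
  - by move=> C /iA/IsB; apply: mem_nth.
  - move=> C D CA DA /eqP; rewrite nth_uniq ?enum_uniq ?IsB ?iA //.
    rewrite nth_uniq ?szA ?iA ?(perm_uniq pIs) ?iota_uniq // => /eqP e.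
    by rewrite -(nth_index set0 CA) e nth_index.
  - move=> C CA; have := congr1 (fun s => nth 0%N s (index C A)) AE.
    rewrite (nth_map set0) ?iA // nth_index // => ->.
    rewrite (nth_map 0%N) ?szA ?iA // (nth_map set0) ?IsB ?iA //.
case=> be [beB be_inj be_card].
(* The default [i] only makes [rep] total; on a nonempty set the choice does not depend on it. *)
pose rep (C : {set 'I_n}) i := odflt i [pick z in C].
have repP (C : {set 'I_n}) i z : z \in C -> rep C i \in C.
  by rewrite /rep => zC; case: pickP => //= /(_ z); rewrite zC.
have repx (C : {set 'I_n}) i j : C != set0 -> rep C i = rep C j.
  by case/set0Pn=> z zC; rewrite /rep; case: pickP => //= /(_ z); rewrite zC.
have xA i : porbit x i \in A by rewrite mem_enum imset_f.
pose a i := rep (porbit x i) i; pose b i := rep (be (porbit x i)) i.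
have aP i : porbit x (a i) = porbit x i.
  by apply/eqP; rewrite eq_porbit_mem; apply: repP (porbit_id x i).
have bne i : be (porbit x i) != set0.
  have := beB _ (xA i); rewrite mem_enum => /porbitsP[c ->].
  by apply/set0Pn; exists c; apply: porbit_id.
have bP i : porbit y (b i) = be (porbit x i).
  have := beB _ (xA i); rewrite mem_enum => /porbitsP[c cE].
  by apply/eqP; rewrite cE eq_porbit_mem /b cE; apply: repP (porbit_id y c).
have bL i : #|porbit y (b i)| = #|porbit x (a i)| by rewrite bP aP be_card.
pose j i := index i (traject x (a i) #|porbit x (a i)|).
have jP i : iter (j i) x (a i) = i.
  have ti : i \in traject x (a i) #|porbit x (a i)|.
    by rewrite -porbit_traject aP porbit_id.
  rewrite -[RHS](nth_index (a i) ti) -/(j i) nth_traject //.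
  by move: ti; rewrite -index_mem size_traject.
pose kf i := iter (j i) y (b i).
(* The exponent is only determined modulo the cycle length, which is common to the two matched
   cycles. *)
have kfP i l : kf (iter l x (a i)) = iter l y (b i).
  set i' := iter l x (a i).
  have pE : porbit x i' = porbit x i.
    have -> : i' = (x ^+ l)%g (a i) by rewrite permX.
    by rewrite porbit_perm aP.
  have aE : a i' = a i.
    by rewrite /a pE; apply: repx; apply/set0Pn; exists i; apply: porbit_id.
  have bE : b i' = b i by rewrite /b pE; apply: repx.
  rewrite /kf bE; apply/eqP; rewrite iter_porbit_inj bL -iter_porbit_inj -aE jP.
  by rewrite aE.
have kfM i : kf (x i) = y (kf i).
  rewrite -{1}(jP i) -iterS kfP iterS; congr (y _).
have kfb i : porbit y (kf i) = be (porbit x i).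
  have -> : kf i = (y ^+ (j i))%g (b i) by rewrite permX.
  by rewrite porbit_perm bP.
have kf_inj : injective kf.
  move=> i i' e; have pE : porbit x i = porbit x i'.
    by apply: be_inj => //; rewrite -!kfb e.
  have aE : a i = a i'.
    by rewrite /a pE; apply: repx; apply/set0Pn; exists i'; apply: porbit_id.
  have bE : b i = b i' by rewrite /b pE; apply: repx.
  rewrite -(jP i) -(jP i'); apply/eqP; rewrite aE iter_porbit_inj -bL -iter_porbit_inj.
  by move/eqP: e; rewrite /kf bE.
exists (perm kf_inj); apply/permP=> i.
rewrite -[i](permKV (perm kf_inj)); set i0 := (perm kf_inj)^-1%g i.
by rewrite permJ !permE kfM.
Qed.

End Conjugacy.

(** * The multiplicity factorial *)

(** Induction on [V]: a colour-preserving permutation that moves only points with colours in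
    [v :: V] factors uniquely into a permutation of the class of [v] and one moving only points with
    colours in [V]. *)
Lemma card_colour_perm (T : finType) (c : T -> nat) (V : seq nat) : uniq V ->
  #|[set s : {perm T} | [forall x, (c (s x) == c x) && ((c x \in V) || (s x == x))]]|
    = (\prod_(i <- V) #|[set x | c x == i]|`!)%N.
Proof.
elim: V => [_|v V IH]; last rewrite cons_uniq => /andP[vV /IH {}IH].
  rewrite big_nil -[RHS](cards1 (1%g : {perm T})); apply: eq_card => s; rewrite !inE.
  apply/forallP/eqP => [h|-> x]; last by rewrite perm1 !eqxx.
  by apply/permP=> x; have /andP[_ /eqP] := h x; rewrite perm1.
rewrite big_cons -IH; set A := [set x | c x == v];
set GV := [set s : {perm T} | [forall x, (c (s x) == c x) && ((c x \in V) || (s x == x))]].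
have cA : #|[set s : {perm T} | perm_on A s]| = #|A|`!.
  by rewrite cardsE card_perm.
rewrite -cA -cardsX -(card_in_imset (f := fun ab => (ab.1 * ab.2)%g)); last first.
  move=> [a b] [a' b'] /setXP[/= aA bGV] /setXP[/= aA' bGV'] /= e.
  rewrite !inE in aA aA'.
  have fixA (d : {perm T}) : d \in GV -> {in A, forall x, d x = x}.
    rewrite inE => /forallP h x; rewrite inE => /eqP cx; have := h x.
    by rewrite cx (negPf vV) /= => /andP[_ /eqP].
  have ea : a = a'.
    apply/permP=> x; case: (boolP (x \in A)) => xA.
      have /permP/(_ x) := e; rewrite !permM (fixA b) ?(fixA b') //.
        by rewrite (perm_closed _ aA').
      by rewrite (perm_closed _ aA).
    by rewrite (out_perm aA) ?(out_perm aA').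
  by move: e; rewrite ea => /mulgI ->.
apply: eq_card => s; apply/idP/imsetP => [|[[a b]] /setXP[/= aon bGV] ->].
  rewrite inE => /forallP h.
  have sN : s \in ('N(A | 'P))%g.
    apply/astabsP=> x; rewrite /= /aperm !inE.
    by have /andP[/eqP -> _] := h x.
  pose a := restr_perm A s.
  have aon : perm_on A a by apply: restr_perm_on.
  exists (a, a^-1 * s)%g; last by rewrite /= mulKVg.
  apply/setXP; split; rewrite inE //=; apply/forallP=> x; rewrite permM.
  have [y ->] : exists y, x = a y by exists (a^-1%g x); rewrite permKV.
  rewrite permK; case: (boolP (y \in A)) => yA.
    by rewrite /a restr_permE // !eqxx orbT.
  rewrite (out_perm aon) //; have /andP[-> /=] := h y; rewrite inE.
  by move: yA; rewrite inE => /negPf ->.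
rewrite !inE in aon bGV; move/forallP: bGV => bV.
rewrite inE; apply/forallP=> x; rewrite permM.
have /andP[/eqP -> bf] := bV (a x).
case: (boolP (x \in A)) => xA.
  have := xA; rewrite -(perm_closed x aon) !inE => /eqP ->.
  by move: xA; rewrite inE => /eqP ->; rewrite !eqxx.
have := bV x; rewrite (out_perm aon) // eqxx /= in_cons.
by move=> /andP[_ /orP[]] ->; rewrite ?orbT.
Qed.

(** Colourings of [l] constant on its own blocks are the length-preserving permutations of the
    blocks, counted by [card_colour_perm]. *)
Lemma phi_self m l : is_comp m.+1 l -> phi (Dset l : {set 'I_m}) (Dset l) = mult_fact l.
Proof.
move=> cl; set G : {set 'I_m} := Dset l.
pose c (j : 'I_(size l)) := nth 0%N l j.
have fibc i : #|[set j | c j == i]| = count_mem i l.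
  rewrite (card_ord_count (size l) (fun j => nth 0%N l j == i)).
  rewrite -[in RHS](mkseq_nth 0%N l) count_map.
  by apply: eq_count.
transitivity #|[set s : 'S_(size l) | [forall j, c (s j) == c j]]|; last first.
  rewrite /mult_fact (eq_bigr (fun i => #|[set j | c j == i]|`!)) => [|i _]; last by rewrite fibc.
  rewrite -card_colour_perm ?undup_uniq //; apply: eq_card => s; rewrite !inE.
  by apply: eq_forallb => j; rewrite mem_undup mem_nth // andbT.
have lt x : (blk G x < size l)%N by rewrite (blk_size cl) ltnS blk_leE.
have szm (j : 'I_(size l)) : (j < m.+1)%N.
  by rewrite (leq_trans (ltn_ord j)) // (blk_size cl) ltnS -[X in (_ <= X)%N]card_ord max_card.
pose vs (s : 'S_(size l)) : {ffun 'I_m.+1 -> 'I_m.+1} :=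
  [ffun x => Ordinal (szm (s (Ordinal (lt x))))].
have surj (j : 'I_(size l)) : exists x, Ordinal (lt x) = j.
  have [] := @blk_surj _ G j; first by rewrite -ltnS -(blk_size cl).
  by move=> x xj; exists x; apply: val_inj.
have fibG (j : nat) : #|[set x | blk G x == j]| = nth 0%N l j by apply: blk_fiber.
rewrite -(card_in_imset (f := vs)); last first.
  move=> s t _ _ /ffunP e; apply/permP=> j; have [x <-] := surj j.
  by apply: val_inj; have := congr1 val (e x); rewrite !ffunE.
apply: eq_card => v; rewrite inE; apply/andP/imsetP => [[]|[s]].
  case/imsetP=> t _ -> /subsetP av.
  have vconst x y : blk G x = blk G y -> blk G (t x) = blk G (t y).
    apply: (@blk_const _ _ _ (fun x => blk G (t x))) => i iG.
    apply/eqP; rewrite -colour_eqE; apply: contraNT iG => ne.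
    by apply: av; rewrite inE.
  pose f (j : 'I_(size l)) : 'I_(size l) :=
    odflt j (omap (fun x => Ordinal (lt (t x))) [pick x | blk G x == j]).
  have fE x : f (Ordinal (lt x)) = Ordinal (lt (t x)).
    rewrite /f; case: pickP => [y /= /eqP e|/(_ x)]; last by rewrite /= eqxx.
    by apply: val_inj; rewrite /=; apply: vconst.
  have f_inj : injective f.
    suff /imset_injP h : #|f @: setT| == #|[set: 'I_(size l)]|.
      by move=> i j e; apply: h e.
    apply/eqP/eq_card => j; rewrite !inE; have [x <-] := surj j.
    by apply/imsetP; exists (Ordinal (lt (t^-1%g x))); rewrite // fE permKV.
  exists (perm f_inj); last first.
    by apply/ffunP=> x; apply: val_inj; rewrite /= colourE ffunE /= permE fE.
  rewrite inE; apply/forallP=> j; rewrite permE /c -!fibG; apply/eqP.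
  rewrite -[RHS](card_imset _ (@perm_inj _ t)); apply: eq_card => y.
  rewrite -[y](permKV t); set x := t^-1%g y; rewrite (mem_imset _ _ (@perm_inj _ t)) !inE.
  have -> : (blk G (t x) == f j) = (Ordinal (lt (t x)) == f j) by [].
  by rewrite -fE (inj_eq f_inj).
rewrite inE => /forallP cs ->; split; last first.
  apply/subsetP=> i; rewrite inE !ffunE; apply: contraR => iG; apply/eqP/val_inj => /=.
  by congr (nat_of_ord (s _)); apply: val_inj; rewrite /= blk_nx (negPf iG).
(* A colouring that uses each colour as often as the standard one is the standard one composed with
   a permutation of the points. *)
suff /tuple_permP[t tE] :
    perm_eq [tuple vs s x | x < m.+1] [tuple colour G 1%g x | x < m.+1].
  apply/imsetP; exists t => //; apply/ffunP=> x.
  have tE' : [tuple vs s x | x < m.+1] =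
      [tuple tnth [tuple colour G 1%g x | x < m.+1] (t i) | i < m.+1] by apply: val_inj.
  have := congr1 (fun u => tnth u x) tE'; rewrite !tnth_mktuple => ->.
  by apply: val_inj; rewrite /= !colourE perm1.
apply/allP=> a _; apply/eqP; rewrite !count_map -!sum1_count -!enumT !big_enum_cond /= !sum1dep_card.
case: (ltnP a (size l)) => la; last first.
  rewrite !eq_card0 // => x; rewrite inE; apply/negP => /eqP/(congr1 val) /=.
    by rewrite colourE => e; have := lt ((1%g : 'S_m.+1) x); rewrite e ltnNge la.
  by rewrite ffunE /= => e; have := ltn_ord (s (Ordinal (lt x))); rewrite e ltnNge la.
pose j := Ordinal la.
rewrite (eq_card (B := [set x | blk G x == (s^-1)%g j])); last first.
  move=> x; rewrite !inE ffunE -[LHS](inj_eq val_inj) /=.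
  have -> : (nat_of_ord (s (Ordinal (lt x))) == a) = (s (Ordinal (lt x)) == j) by [].
  by rewrite -{1}[j](permKV s) (inj_eq perm_inj).
rewrite fibG -/(c _) -(eqP (cs _)) permKV /c -fibG; apply: eq_card => x; rewrite !inE.
by rewrite -[RHS](inj_eq val_inj) /= colourE perm1.
Qed.

(** * Glaisher's correspondence *)

(* Invariant under merging [p] equal parts [x] into the single part [p * x]. *)
Definition pweight (p i : nat) (l : seq nat) : nat :=
  (\sum_(x <- l | x`_p^' == i) x`_p)%N.

Lemma pweight_perm p i l l' : perm_eq l l' -> pweight p i l = pweight p i l'.
Proof. exact: perm_big. Qed.

Lemma pweight_nseq p i k x : pweight p i (nseq k x) = (k * ((x`_p^' == i) * x`_p))%N.
Proof.
rewrite /pweight; elim: k => [|k IH] /=; first by rewrite big_nil.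
by rewrite big_cons IH mulSn; case: (_ == i); rewrite ?mul1n ?mul0n ?muln0.
Qed.

Lemma pweight_merge p i x l : prime p -> (0 < x)%N ->
  pweight p i ((p * x)%N :: l) = pweight p i (nseq p x ++ l).
Proof.
move=> pp x0; have p0 := prime_gt0 pp.
rewrite {2}/pweight big_cat /= -!/(pweight _ _ _) pweight_nseq {1}/pweight big_cons -/(pweight _ _ _).
have -> : ((p * x)`_p = p * x`_p)%N by rewrite partnM // part_pnat_id // pnat_id.
have -> : ((p * x)`_p^' = x`_p^')%N.
  by rewrite partnM // part_p'nat ?mul1n // pnatNK pnat_id.
by case: (_ == i); rewrite ?mul1n ?mul0n ?muln0.
Qed.

(** Each merge of [p] equal parts shortens the list, keeps the sum and keeps every [pweight]; it
    stops at a [p]-regular list. *)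
Lemma merge_ex p l : prime p -> pos l -> exists2 l', pos l' &
  [/\ sumn l' = sumn l, all (fun i => count_mem i l' < p)%N l' &
      forall i, pweight p i l' = pweight p i l].
Proof.
move=> pp; have [k] := ubnP (size l); elim: k l => // k IH l /ltnSE lek pl.
case: (boolP (all (fun i => count_mem i l < p)%N l)) => [al|/allPn[x xl]].
  by exists l.
rewrite -leqNgt => px; have x0 : (0 < x)%N by apply: (allP pl).
pose r := nseq (count_mem x l - p) x ++ [seq y <- l | y != x].
have lr : perm_eq l (nseq p x ++ r).
  rewrite /r catA -nseqD subnKC // -(perm_filterC (pred1 x) l).
  by rewrite (all_pred1P _ _ (filter_all (pred1 x) l)) size_filter.
have pr : pos r by move: pl; rewrite (perm_all _ lr) all_cat => /andP[].
have [||l' pl' [sl' al' wl']] := IH ((p * x)%N :: r).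
- rewrite /= (leq_trans _ lek) // (perm_size lr) size_cat size_nseq.
  by rewrite -add2n leq_add2r prime_gt1.
- by rewrite /= muln_gt0 prime_gt0 // x0.
exists l' => //; split=> // [|i]; last by rewrite wl' pweight_merge // (pweight_perm _ _ lr).
by rewrite sl' (perm_sumn lr) sumn_cat sumn_nseq mulnC.
Qed.

(** Hence the weights determine a partition whose parts are prime to [p]. *)
Lemma pweight_p' p i l : pos l -> all (coprime p) l -> prime p -> pweight p i l = count_mem i l.
Proof.
move=> pl cl pp; rewrite -sum1_count /pweight [LHS]big_seq_cond [RHS]big_seq_cond.
have h x : x \in l -> (x`_p = 1)%N /\ (x`_p^' = x)%N.
  move=> xl; have x0 := allP pl _ xl; have cx := allP cl _ xl.
  have px : p^'.-nat x by rewrite p'natE // -prime_coprime.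
  by rewrite part_p'nat // part_pnat_id.
by apply: eq_big => x /=; case: (boolP (x \in l)) => //= /h[e1 e2]; rewrite ?e1 ?e2.
Qed.

(** Pigeonhole for a relation that is injective from right to left; with a relation, no function
    performing the merges has to be chosen. *)
Lemma size_le_rel (T U : eqType) (R : T -> U -> Prop) (s : seq T) (t : seq U) :
  uniq s -> uniq t -> (forall x, x \in s -> exists2 y, y \in t & R x y) ->
  (forall x x' y, x \in s -> x' \in s -> R x y -> R x' y -> x = x') ->
  (size s <= size t)%N.
Proof.
elim: s t => // x s IH t /andP[xs us] ut ex inj.
have [y yt Rxy] := ex x (mem_head _ _).
rewrite -(subnKC (_ : 1 <= size t)%N) ?add1n; last by case: t yt {ut ex}.
rewrite /= ltnS subn1 -(size_rem yt); apply: IH => //; first exact: rem_uniq.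
  move=> z zs; have zxs : z \in x :: s by rewrite inE zs orbT.
  have [w wt Rzw] := ex z zxs; exists w => //.
  rewrite mem_rem_uniq // inE wt andbT; apply: contraNneq xs => wy.
  by rewrite wy in Rzw; rewrite (inj x z y) ?mem_head.
by move=> z z' w zs z's; apply: inj; rewrite inE ?zs ?z's orbT.
Qed.

Lemma geq_trans : transitive geq.
Proof. by move=> b a c h1 h2; apply: leq_trans h2 h1. Qed.
Lemma geq_total : total geq.
Proof. by move=> a b; apply: leq_total. Qed.
Lemma geq_anti : antisymmetric geq.
Proof. by move=> a b; rewrite andbC => /anti_leq. Qed.

Lemma partition_perm_eq n l l' : is_partition n l -> is_partition n l' -> perm_eq l l' -> l = l'.
Proof.
move=> /andP[_ sl] /andP[_ sl'] pll'.
by apply: (sorted_eq geq_trans geq_anti).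
Qed.

Definition p'_parts (p n : nat) :=
  [seq l <- compositions n | is_partition n l && all (coprime p) l].

Lemma size_p'_parts p n : prime p -> (size (p'_parts p n) <= size (preg_parts p n))%N.
Proof.
move=> pp; apply: (@size_le_rel _ _ (fun l l' => forall i, pweight p i l' = pweight p i l)).
- by apply: filter_uniq; apply: compositions_uniq.
- by apply: filter_uniq; apply: compositions_uniq.
- move=> l; rewrite mem_filter => /andP[/andP[/andP[/andP[pl /eqP sl] _] _] _].
  have [l' pl' [sl' al' wl']] := merge_ex pp pl.
  exists (sort geq l') => [|i]; last first.
    by rewrite -wl'; apply: pweight_perm; rewrite perm_sort.
  have cl' : is_comp n (sort geq l').
    rewrite /is_comp (perm_all _ (permEl (perm_sort geq l'))) pl' /=.
    by rewrite (perm_sumn (permEl (perm_sort geq l'))) sl' sl.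
  rewrite mem_filter mem_compositions cl' andbT /preg_part /is_partition cl' /=.
  rewrite (sort_sorted geq_total) /= (perm_all _ (permEl (perm_sort geq l'))).
  by apply: sub_all al' => i; rewrite (seq.permP (permEl (perm_sort geq l'))).
move=> l l' w; rewrite !mem_filter.
move=> /andP[/andP[Pl cl] _] /andP[/andP[Pl' cl'] _] wl wl'.
apply: (partition_perm_eq Pl Pl'); apply/allP=> i _; apply/eqP.
have pl : pos l by case/andP: Pl => /andP[].
have pl' : pos l' by case/andP: Pl' => /andP[].
by rewrite -(pweight_p' i pl cl pp) -(pweight_p' i pl' cl' pp) -wl -wl'.
Qed.

(** * p-equivalence classes *)

Lemma cycle_type_partition n (s : 'S_n) : is_partition n (cycle_type s).
Proof.
apply/andP; split; last exact: sort_sorted geq_total _.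
rewrite /is_comp !(perm_all _ (permEl (perm_sort geq _))) (perm_sumn (permEl (perm_sort geq _))).
apply/andP; split.
  apply/allP=> k /mapP[C]; rewrite mem_enum => /porbitsP[a ->] ->.
  by rewrite lt0n card_porbit_neq0.
rewrite sumnE big_map big_enum /= -[X in _ == X]card_ord -sum1_card.
rewrite (partition_big (porbit s) (mem (porbits s))) /=; last by move=> i _; apply: imset_f.
apply/eqP/eq_bigr => C /porbitsP[a ->]; rewrite -sum1_card; apply: eq_bigl => i.
by rewrite eq_porbit_mem.
Qed.

Lemma cycle_type_p' p n (s : 'S_n) : prime p -> (p^'.-elt s)%g -> all (coprime p) (cycle_type s).
Proof.
move=> pp ps; rewrite (perm_all _ (permEl (perm_sort geq _))).
apply/allP=> k /mapP[C]; rewrite mem_enum => /porbitsP[a ->] ->.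
rewrite prime_coprime // -p'natE ?lt0n ?card_porbit_neq0 //.
by apply: pnat_dvd ps; rewrite porbitE; apply: dvdn_orbit.
Qed.

Section PClass.
Variables (F : fieldType) (p m : nat).
Hypotheses (pp : prime p) (pchF : p \in [pchar F]).
Local Notation n := m.+1.
Implicit Types (l : seq nat) (g : 'S_n) (E G : {set 'I_m}).

Lemma natr_eqmod (a b : nat) : a = b %[mod p] -> a%:R = b%:R :> F.
Proof. by move=> e; rewrite -(GRing.natr_mod_pchar pchF a) e GRing.natr_mod_pchar. Qed.

Lemma preg_partition l : preg_part p n l -> is_partition n l.
Proof. by case/andP. Qed.

Lemma preg_comp l : preg_part p n l -> is_comp n l.
Proof. by case/andP=> /andP[]. Qed.

Lemma fact_neq0 k : (k < p)%N -> k`!%:R != 0 :> F.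
Proof.
elim: k => [|k IH] kp; first by rewrite fact0 oner_neq0.
rewrite factS natrM mulf_neq0 ?IH 1?ltnW // -(dvdn_pcharf pchF).
by rewrite gtnNdvd.
Qed.

Lemma mult_fact_neq0 l : preg_part p n l -> (mult_fact l)%:R != 0 :> F.
Proof.
case/andP=> _ /allP h; rewrite /mult_fact natr_prod prodf_seq_neq0; apply/allP=> i.
by rewrite mem_undup => /h/fact_neq0.
Qed.

Lemma cycle_type_partperm l : is_partition n l -> cycle_type (bperm (Dset l : {set 'I_m})) = l.
Proof.
case/andP=> cl sl; rewrite cycle_type_bperm Dset_K //.
by apply: (sorted_sort geq_trans).
Qed.

Lemma fixc_pconj G g h : (g.`_p^' \in h.`_p^' ^: [set: 'S_n])%g ->
  (fixc G g)%:R = (fixc G h)%:R :> F.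
Proof.
case/imsetP=> k _ e; rewrite (natr_eqmod (fixc_constt p G g)) e fixc_conj.
by rewrite -(natr_eqmod (fixc_constt p G h)).
Qed.

Lemma in_pclass_fixc l g G : is_partition n l -> in_pclass p l g ->
  (fixc G g)%:R = (phi G (Dset l))%:R :> F.
Proof.
move=> Pl /existsP[h /andP[/eqP ch]] /(fixc_pconj G) ->.
have [k ->] : exists k, h = (bperm (Dset l : {set 'I_m}) ^ k)%g.
  by apply: cycle_type_conj; rewrite cycle_type_partperm.
by rewrite fixc_conj fixc_bperm.
Qed.

Lemma WR_anti l l' : is_partition n l -> is_partition n l' ->
  WR (Dset l : {set 'I_m}) (Dset l') -> (size l <= size l')%N -> l = l'.
Proof.
move=> Pl Pl' w le; have [cl _] := andP Pl; have [cl' _] := andP Pl'.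
have [le' eqs] := WR_card cl cl' w.
by apply: (partition_perm_eq Pl Pl'); apply: eqs; apply/anti_leq; rewrite le.
Qed.

(** The diagonal value [phi l l] is the factorial [[l]!], nonzero in [F]; equal values therefore
    make each partition a weak refinement of the other. *)
Lemma phi_preg_inj l l' : preg_part p n l -> preg_part p n l' ->
  (forall G : {set 'I_m}, (phi G (Dset l))%:R = (phi G (Dset l'))%:R :> F) -> l = l'.
Proof.
move=> rl rl' h.
have nz a b : preg_part p n a -> (phi (Dset a : {set 'I_m}) (Dset a))%:R =
    (phi (Dset a : {set 'I_m}) (Dset b))%:R :> F -> WR (Dset b : {set 'I_m}) (Dset a).
  move=> ra; rewrite phi_self ?preg_comp // => e; apply: phi_WR.
  by apply: contraNneq (mult_fact_neq0 ra) => e0; rewrite e e0.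
have w1 := nz _ _ rl (h _); have w2 := nz _ _ rl' (esym (h _)).
have [le _] := WR_card (preg_comp rl') (preg_comp rl) w1.
by apply/esym/(WR_anti _ _ w1) => //; rewrite ?preg_partition //;
   have [] := WR_card (preg_comp rl) (preg_comp rl') w2.
Qed.

(** The [p']-parts attached to [p]-regular partitions have pairwise different cycle types, and by
    [size_p'_parts] there are enough of them to exhaust all [p']-types, including that of the
    [p']-part of [g]. *)
Lemma in_pclass_ex g : exists2 l, preg_part p n l & in_pclass p l g.
Proof.
pose ct l := cycle_type ((bperm (Dset l : {set 'I_m})).`_p^')%g.
pose s1 := [seq ct l | l <- preg_parts p n].
have mem_preg l : (l \in preg_parts p n) = preg_part p n l.
  rewrite mem_filter mem_compositions andb_idr //; exact: preg_comp.
have memP' (x : 'S_n) : (p^'.-elt x)%g -> cycle_type x \in p'_parts p n.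
  move=> px; have Px := cycle_type_partition x.
  by rewrite mem_filter Px cycle_type_p' // mem_compositions; case/andP: Px.
have us1 : uniq s1.
  rewrite map_inj_in_uniq; first exact/filter_uniq/compositions_uniq.
  move=> l l'; rewrite !mem_preg => rl rl' /cycle_type_conj[k e].
  apply: phi_preg_inj => // G; rewrite -!fixc_bperm; apply/esym/fixc_pconj.
  by rewrite e imset_f ?inE.
have sub : {subset s1 <= p'_parts p n}.
  by move=> _ /mapP[l _ ->]; apply: memP'; apply: p_elt_constt.
have [|_ eqi] := uniq_min_size us1 sub; first by rewrite size_map size_p'_parts.
have := memP' _ (p_elt_constt p^' g); rewrite -eqi => /mapP[l]; rewrite mem_preg => rl.
move/esym/cycle_type_conj=> [k e]; exists l => //; apply/existsP; exists (bperm (Dset l)).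
by rewrite cycle_type_partperm ?preg_partition // eqxx e imset_f ?inE.
Qed.

End PClass.

(** * Lifting idempotents *)

(** A polynomial identity: [P] is divisible by ['X^N] and [1 - P] by [(1 - 'X) ^+ N], so
    [P * (1 - P)] is a multiple of [('X * (1 - 'X)) ^+ N]. The factor [y ^+ N] on both sides is
    recorded for orthogonality. *)
Lemma lift_idem (F : fieldType) (A : algType F) (y : A) N : (y * (1 - y)) ^+ N = 0 ->
  let e := 1 - (1 - y ^+ N) ^+ N in
  e * e = e /\ exists T, e = y ^+ N * T /\ e = T * y ^+ N.
Proof.
move=> y0 e; pose P : {poly F} := 1 - (1 - 'X^N) ^+ N.
pose h : {rmorphism {poly F} -> A} := horner_alg y.
have hX : h 'X = y by exact: horner_algX.
have hP : h P = e by rewrite /P /e !rmorphB !rmorphXn !rmorphB rmorph1 !rmorphXn hX.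
pose T : {poly F} := \sum_(i < N) (1 - 'X^N) ^+ i.
have PE : P = 'X^N * T.
  by rewrite /P -opprB subrX1 -/T addrAC subrr add0r mulNr opprK.
have QE : 1 - P = (1 - 'X) ^+ N * (\sum_(i < N) 'X^i) ^+ N.
  rewrite /P opprB addrC subrK -exprMn; congr (_ ^+ _).
  by rewrite -opprB subrX1 -mulNr opprB.
have PQ : P * (1 - P) = ('X * (1 - 'X)) ^+ N * (T * (\sum_(i < N) 'X^i) ^+ N).
  by rewrite QE PE exprMn mulrACA.
have : e * (1 - e) = 0.
  by rewrite -hP -[1](rmorph1 h) -rmorphB -rmorphM PQ rmorphM rmorphXn rmorphM rmorphB rmorph1 hX y0 mul0r.
rewrite mulrBr mulr1 => /eqP; rewrite subr_eq0 => /eqP ee; split; first exact/esym.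
exists (h T); rewrite -hP PE; split; first by rewrite rmorphM rmorphXn hX.
by rewrite mulrC rmorphM rmorphXn hX.
Qed.

(** * Construction of the orthogonal idempotents *)

Section Main.
Variables (F : fieldType) (p m : nat).
Hypotheses (pp : prime p) (pchF : p \in [pchar F]).
Local Notation n := m.+1.
Local Notation A := (galg F n).
Local Notation XI := (@XI m F).
Local Notation D l := (Dset l : {set 'I_m}).
Local Notation preg := (preg_part p n).
Implicit Types (x y z u : A) (l : seq nat) (E G w : {set 'I_m}).

Lemma chi_preg E : exists2 l, preg l & forall x, inD x -> chi E x = chi (D l) x.
Proof.
have [l rl cl] := in_pclass_ex pp pchF (bperm E); exists l => // x Dx.
rewrite !chi_coef //; apply: eq_bigr => G _.
by rewrite -fixc_bperm (in_pclass_fixc pchF G (preg_partition rl) cl).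
Qed.

Lemma chi_preg_nil x : inD x -> (forall l, preg l -> chi (D l) x = 0) -> x ^+ n = 0.
Proof.
by move=> Dx h; apply: chi_nil => // E; have [l /h rl ->] := chi_preg E.
Qed.

(** Such a [u] is nilpotent, yet all its positive powers equal [u]. *)
Lemma idem_eq0 u : inD u -> u * u = u -> (forall l, preg l -> chi (D l) u = 0) -> u = 0.
Proof.
move=> Du uu h; rewrite -(chi_preg_nil Du h).
suff uX k : u ^+ k.+1 = u by rewrite uX.
by elim: k => [|k IH]; rewrite ?expr1 // exprS IH uu.
Qed.

Lemma WR_leq w G : WR w G -> (#|G| <= #|w|)%N.
Proof.
rewrite -{1}(comp_of_K w) -{1}(comp_of_K G) => h.
have [+ _] := WR_card (comp_of_comp w) (comp_of_comp G) h.
by rewrite !(blk_size (comp_of_comp _)) !comp_of_K.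
Qed.

(** Otherwise [w] would have as few parts as [l], hence be a rearrangement of both partitions, which
    would then coincide. *)
Lemma WR_lt w l l' : preg l -> preg l' -> l != l' -> (size l <= size l')%N ->
  WR w (D l) -> WR w (D l') -> (#|D l| < #|w|)%N.
Proof.
move=> rl rl' ne le wl wl'; rewrite ltnNge; apply: contra ne => lew.
have cw := comp_of_comp w; have cl := preg_comp rl; have cl' := preg_comp rl'.
rewrite -(comp_of_K w) in wl wl'.
have [s1 e1] := WR_card cw cl wl; have [s2 e2] := WR_card cw cl' wl'.
have s3 : (size (comp_of w) <= size l)%N.
  by rewrite (blk_size cw) (blk_size cl) comp_of_K ltnS.
have p1 : perm_eq (comp_of w) l by apply: e1; apply/anti_leq; rewrite s3.
have p2 : perm_eq (comp_of w) l'.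
  by apply: e2; apply/anti_leq; rewrite s2 andbT (leq_trans s3).
apply/eqP; apply: (partition_perm_eq (preg_partition rl) (preg_partition rl')).
by rewrite -(permPl p1).
Qed.

(** Among the weak refinements of [l], the strict ones are those with more parts, so a cardinality
    replaces the condition of not being a rearrangement. The span [low l] is a two-sided ideal of
    the descent algebra. *)
Definition lower l : pred {set 'I_m} := [pred w | WR w (D l) && (#|D l| < #|w|)%N].
Definition low l x := inspan (lower l) x.

Lemma lowMr l x y : low l x -> inD y -> low l (x * y).
Proof.
move=> lx Dy; apply: inspan_mul lx Dy _ => E G w /andP[wE cE] _ sEw wwE _; rewrite /lower /=.
by rewrite (WR_trans wwE wE) (leq_trans cE (subset_leq_card sEw)).
Qed.

Lemma lowMl l x y : inD x -> low l y -> low l (x * y).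
Proof.
move=> Dx ly; apply: inspan_mul Dx ly _ => E G w _ /andP[wG cG] _ _ wwG; rewrite /lower /=.
by rewrite (WR_trans wwG wG) (leq_trans cG (WR_leq wwG)).
Qed.

Lemma inD_sub x y : inD x -> inD y -> inD (x - y).
Proof. exact: inspanB. Qed.

Lemma low_idemX l u k : inD u -> low l (u * u - u) -> low l (u ^+ k.+1 - u).
Proof.
move=> Du lu; elim: k => [|k IH]; first by rewrite expr1 subrr; apply: inspan0.
rewrite exprS -(subrK (u * u) (u * _)) -addrA -mulrBr.
by apply: inspanD => //; apply: lowMl.
Qed.

Lemma low_idem l x y : inD x -> inD y -> low l (y - x) -> low l (x * x - x) -> low l (y * y - y).
Proof.
move=> Dx Dy ld lx.
have -> : y * y - y = y * (y - x) + (y - x) * x + (x * x - x) - (y - x).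
  by rewrite mulrBr mulrBl !addrA opprB !addrA !subrK.
by apply: inspanB => //; apply: inspanD => //; apply: inspanD; [apply: lowMl|apply: lowMr].
Qed.

Definition lead l : A := ((mult_fact l)%:R)^-1 *: XI (D l).

Lemma lead_inD l : inD (lead l).
Proof. by apply: inspanZ; apply: inspan_XI. Qed.

(** The square of [XI (D l)] is [[l]!] times itself plus strictly finer terms, by triangularity and
    [phi_self]. *)
Lemma lead_idem l : preg l -> low l (lead l * lead l - lead l).
Proof.
move=> rl; have c0 := mult_fact_neq0 pchF rl.
rewrite /lead -scalerAl -scalerBr; apply: inspanZ; rewrite -scalerAr.
have DX : inD (XI (D l)) by apply: inspan_XI.
have := XI_mulr (D l) DX; rewrite chi_XI phi_self ?(preg_comp rl) // => h.
have {h} := inspanZ (mult_fact l)%:R^-1 h; rewrite scalerBr scalerA mulVf // scale1r => h.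
apply: inspan_sub h => w; rewrite inE => pw.
by rewrite inE /= (WR_sub (proper_sub pw)) proper_card.
Qed.


Lemma low_span l (e : A) : low l (e - lead l) -> inspan [pred w | WR w (D l)] e.
Proof.
move=> le; rewrite -(subrK (lead l) e); apply: inspanD.
  by apply: inspan_sub le => w /andP[].
by apply: inspanZ; apply: inspan_XI => /=; apply: WR_sub.
Qed.

(** The invariant of the construction for the partitions [s] already treated. The last clause tests
    against every [p]-regular partition, not only those in [s]. *)
Definition good (s : seq (seq nat)) (e : seq nat -> A) :=
  [/\ forall l, l \in s -> low l (e l - lead l),
      forall l, l \in s -> e l * e l = e l,
      forall l l', l \in s -> l' \in s -> l != l' -> e l * e l' = 0 &
      forall l l', l \in s -> preg l' -> chi (D l') (e l) = (l' == l)%:R].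

Lemma good_inD s e l : good s e -> l \in s -> inD (e l).
Proof. by case=> h _ _ _ /h/low_span; apply: inspan_inD. Qed.

Section Sum.
Variables (s : seq (seq nat)) (e : seq nat -> A).
Hypotheses (us : uniq s) (gs : good s e).
Let E := \sum_(l <- s) e l.

Lemma good_sum_inD : inD E.
Proof. by rewrite /E big_seq; apply: inspan_sum => l; apply: good_inD gs. Qed.

Lemma good_sumMl l : l \in s -> e l * E = e l.
Proof.
case: gs => _ ee eo _ ls; rewrite /E mulr_sumr (bigD1_seq l) //= ee //.
rewrite big1_seq ?addr0 // => l' /andP[ne l's]; apply: eo => //; by rewrite eq_sym.
Qed.

Lemma good_sumMr l : l \in s -> E * e l = e l.
Proof.
case: gs => _ ee eo _ ls; rewrite /E mulr_suml (bigD1_seq l) //= ee //.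
by rewrite big1_seq ?addr0 // => l' /andP[ne l's]; apply: eo.
Qed.

Lemma good_sum_idem : E * E = E.
Proof.
transitivity (\sum_(l <- s) e l * E); first by rewrite -mulr_suml.
by apply: eq_big_seq => l; apply: good_sumMl.
Qed.

Lemma good_sum_chi l : preg l -> chi (D l) E = (l \in s)%:R.
Proof.
case: gs => _ _ _ ce rl; rewrite chi_sum big_seq.
rewrite (eq_bigr (fun l' => (l == l')%:R)) => [|l' l's]; last exact: ce.
rewrite -big_seq; case: (boolP (l \in s)) => ls.
  rewrite (bigD1_seq l) //= eqxx big1 ?addr0 // => l' /negPf ne.
  by rewrite eq_sym ne.
by rewrite big1_seq // => l' /= l's; case: eqP ls l's => // -> /negPf ->.
Qed.

End Sum.

Lemma good_step s t e l : uniq (s ++ l :: t) -> (forall k, (k \in s ++ l :: t) = preg k) ->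
  (forall k, k \in s -> (size l <= size k)%N) -> (forall k, k \in t -> (size k <= size l)%N) ->
  good s e -> exists e', good (rcons s l) e'.
Proof.
move=> ust mem_st ges let_ gs.
have rl : preg l by rewrite -mem_st mem_cat mem_head orbT.
have rs k : k \in s -> preg k by rewrite -mem_st mem_cat => ->.
have us : uniq s by move: ust; rewrite cat_uniq => /and3P[].
have ls : l \notin s by move: ust; rewrite cat_uniq /= negb_or => /and3P[_ /andP[]].
pose E := \sum_(k <- s) e k; pose x := lead l; pose y := (1 - E) * x * (1 - E).
have DE : inD E by apply: good_sum_inD gs.
have D1E : inD (1 - E) by apply: inD_sub => //; apply: inD1.
have Dx : inD x by apply: lead_inD.
have Dy : inD y by do 2!apply: inD_mul => //.
have lxI : inspan (pred1 (D l)) x by apply: inspanZ; apply: inspan_XI; rewrite /= eqxx.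
(* Every term of [e k * x] weakly refines both [k] and [l]; as these differ and [k] has at least as
   many parts, it is strictly finer than [l]. *)
have lowEx : low l (E * x).
  rewrite /E mulr_suml big_seq; apply: inspan_sum => k ks.
  have [lk _ _ _] := gs.
  apply: inspan_mul (low_span (lk k ks)) lxI _ => E' G w wk /eqP -> _ wE' wl; rewrite /lower /=.
  rewrite wl (WR_lt rl (rs _ ks) _ (ges _ ks) wl (WR_trans wE' wk)) //.
  by apply: contraNneq ls => ->.
have lowxE : low l (x * E).
  rewrite /E mulr_sumr big_seq; apply: inspan_sum => k ks.
  have [lk _ _ _] := gs.
  apply: inspan_mul lxI (low_span (lk k ks)) _ => E' G w /eqP -> wk _ wl wG; rewrite /lower /=.
  rewrite wl (WR_lt rl (rs _ ks) _ (ges _ ks) wl (WR_trans wG wk)) //.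
  by apply: contraNneq ls => ->.
have lowy : low l (y - x).
  have -> : y - x = E * x * E - E * x - x * E.
    rewrite /y mulrBl mul1r mulrBr mulr1 mulrBl opprB.
    by rewrite addrAC [x - _ - x]addrAC subrr add0r addrCA addrA.
  by apply: inspanB => //; apply: inspanB => //; apply: lowMr.
have lowyy : low l (y * y - y) by apply: low_idem (Dx) _ lowy (lead_idem rl).
(* For [k] in [s] the factor [1 - E] has character 0; for [k = l] the scaling gives 1; the remaining
   [k], in [t], have at most as many parts as [l], so they cannot refine [l] and [phi] vanishes. *)
have chiy k : preg k -> chi (D k) y = (k == l)%:R.
  move=> rk; rewrite !chiM //; last exact: inD_mul.
  rewrite !chiB !chi1 (good_sum_chi us gs) // chiZ chi_XI.
  case: (boolP (k \in s)) => ks.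
    rewrite subrr mulr0; case: eqP ks ls => // -> -> //.
  rewrite subr0 mul1r mulr1; case: (eqVneq k l) => [->|ne].
    by rewrite (phi_self (preg_comp rl)) mulVf ?(mult_fact_neq0 pchF rl).
  have kt : k \in t.
    by have := mem_st k; rewrite rk mem_cat inE (negPf ks) (negPf ne).
  case: (eqVneq (phi (D l) (D k)) 0%N) => [->|/phi_WR w]; first by rewrite mulr0.
  by case/eqP: ne; apply: WR_anti (preg_partition rk) (preg_partition rl) w (let_ _ kt).
have ynil : (y * (1 - y)) ^+ n = 0.
  have D1y : inD (1 - y) by apply: inD_sub => //; apply: inD1.
  apply: chi_preg_nil => [|k rk]; first exact: inD_mul.
  by rewrite chiM // chiB chi1 chiy //; case: (k == l); rewrite ?subrr ?mulr0 ?mul0r.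
have [] := lift_idem ynil; set f := 1 - _ => ff [T [fT fT']].
have Dz : inD (y ^+ n) by apply: inD_exp.
have D1z : inD (1 - y ^+ n) by apply: inD_sub => //; apply: inD1.
have Df : inD f by apply: inD_sub; [apply: inD1|apply: inD_exp].
have lowz : low l (y ^+ n - y) by apply: low_idemX.
have lowf : low l (f - x).
  have lzz : low l (y ^+ n * y ^+ n - y ^+ n) by apply: low_idem (Dy) _ lowz lowyy.
  have l1z : low l ((1 - y ^+ n) * (1 - y ^+ n) - (1 - y ^+ n)).
    set z := y ^+ n in lzz *.
    have -> : (1 - z) * (1 - z) - (1 - z) = z * z - z.
      by rewrite mulrBr mulr1 addrAC subrr add0r mulrBl mul1r opprB.
    exact: lzz.
  have l1 := low_idemX m D1z l1z.
  have -> : f - x = - ((1 - y ^+ n) ^+ n - (1 - y ^+ n)) + (y ^+ n - y) + (y - x).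
    rewrite /f; move: ((1 - y ^+ n) ^+ n) (y ^+ n) => U z; rewrite opprB !addrA subrK.
    by congr (_ - x); rewrite [RHS]addrAC subrK.
  by apply: inspanD => //; apply: inspanD => //; apply: inspanN.
(* Since [f] has a factor [y ^+ n] on either side, orthogonality to [y] passes to [f]. *)
have ey k : k \in s -> e k * y = 0.
  by move=> ks; rewrite /y !mulrA [e k * (1 - E)]mulrBr mulr1 (good_sumMl us gs ks : e k * E = e k) subrr !mul0r.
have ye k : k \in s -> y * e k = 0.
  by move=> ks; rewrite /y -!mulrA [(1 - E) * e k]mulrBl mul1r (good_sumMr us gs ks : E * e k = e k) subrr !mulr0.
clearbody y; have [g1 g2 g3 g4] := gs.
exists (fun k => if k == l then f else e k); split.
- move=> k; rewrite mem_rcons inE; case: eqP => [->|_ /=]; [by []|exact: g1].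
- move=> k; rewrite mem_rcons inE; case: eqP => [_|_ /=]; [by []|exact: g2].
- move=> k k'; rewrite !mem_rcons !inE.
  case: (eqVneq k l) => [->|nk] /=; case: (eqVneq k' l) => [->|nk'] //=.
  + by move=> _ k's _; rewrite fT' exprSr -!mulrA  ye // !mulr0.
  + by move=> ks _ _; rewrite fT exprS !mulrA ey ?mul0r.
  + exact: g3.
- move=> k k'; rewrite mem_rcons inE; case: (eqVneq k l) => [->|nk] /=; last exact: g4.
  move=> _ rk; rewrite /f chiB chi1 chiX // chiB chi1 chiX // chiy //.
  by case: (k' == l); rewrite ?expr1n ?expr0n /= ?subrr ?expr0n ?subr0 ?expr1n ?subrr.
Qed.

Lemma mem_preg_parts l : (l \in preg_parts p n) = preg l.
Proof. rewrite mem_filter mem_compositions andb_idr //; exact: preg_comp. Qed.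

Lemma good_ex : exists e, good (preg_parts p n) e.
Proof.
pose ge_size (a b : seq nat) := (size b <= size a)%N.
pose L := sort ge_size (preg_parts p n).
have pL : perm_eq L (preg_parts p n) by rewrite perm_sort.
have uL : uniq L by rewrite sort_uniq; apply/filter_uniq/compositions_uniq.
have memL l : (l \in L) = preg l by rewrite (perm_mem pL) mem_preg_parts.
have trL : transitive ge_size by move=> b a c h1 h2; apply: leq_trans h2 h1.
have sL : pairwise ge_size L.
  by rewrite -sorted_pairwise //; apply: sort_sorted => a b; apply: leq_total.
suff [e [g1 g2 g3 g4]] : exists e, good L e.
  exists e; split.
  - by move=> l; rewrite -(perm_mem pL); apply: g1.
  - by move=> l; rewrite -(perm_mem pL); apply: g2.
  - by move=> l l'; rewrite -!(perm_mem pL); apply: g3.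
  - by move=> l l'; rewrite -(perm_mem pL); apply: g4.
(* Induction over the prefixes of the sorted list, the suffix [t] holding the shorter or equally
   long partitions still to come. *)
suff: forall s t, s ++ t = L -> exists e, good s e by move/(_ L [::]); apply; rewrite cats0.
elim/last_ind=> [|s l IH] t; first by exists (fun=> 0).
rewrite cat_rcons => stL; have [e ge] := IH _ stL; move: sL uL memL; rewrite -stL.
rewrite pairwise_cat allrel_consr pairwise_cons => /and3P[/andP[/allP sl _] _ /andP[/allP lt _]].
by move=> ust mem_st; apply: (good_step ust mem_st _ _ ge) => k; [apply: sl | apply: lt].
Qed.

(** * Primitivity, completeness and the return to compositions *)

Lemma lincomb_Xi (a : seq nat -> F) : lincomb a (Xi F n) = \sum_E a (comp_of E) *: XI E.
Proof.
apply/ffunP=> s; rewrite ffunE sum_compositions sum_ffunE; apply: eq_bigr => E _.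
by rewrite galgZE Xi_XI comp_of_K.
Qed.

Lemma in_descent_algP x : in_descent_alg x <-> inD x.
Proof.
split=> [[a ->]|Dx]; first by exists (fun E => a (comp_of E)); rewrite lincomb_Xi.
exists (fun q => xcoef (D q) x); rewrite lincomb_Xi {1}(inD_coef Dx).
by apply: eq_bigr => E _; rewrite comp_of_K.
Qed.

Lemma idem_chi u E : inD u -> u * u = u -> chi E u = 0 \/ chi E u = 1.
Proof.
move=> Du uu; have := chiM E Du Du; rewrite uu => /eqP.
rewrite -{1}[chi E u]mulr1 -subr_eq0 -mulrBr mulf_eq0 subr_eq0 => /orP[]/eqP; first by left.
by right.
Qed.

(** In a splitting [f + g] the characters of [f] and [g] have product 0 and add up to those of
    [e l]. So away from [l] both vanish, at [l] one does, and that summand is zero by [idem_eq0]. *)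
Lemma good_primitive e l : good (preg_parts p n) e -> preg l -> primitive_idem (e l).
Proof.
move=> ge rl; have ls : l \in preg_parts p n by rewrite mem_preg_parts.
have De := good_inD ge ls; have [_ g2 _ g4] := ge; split.
- exact/in_descent_algP.
- apply/eqP => e0; have := g4 l l ls rl; rewrite e0 eqxx /chi mulr0 xcoef0 => /eqP.
  by rewrite eq_sym oner_eq0.
- exact: g2.
move=> f g /in_descent_algP Df /in_descent_algP Dg ff gg fg gf efg.
have chi_fg k : preg k -> chi (D k) f + chi (D k) g = (k == l)%:R.
  by move=> rk; rewrite -chiD -(g4 l k ls rk) efg.
have chi_prod k : chi (D k) f * chi (D k) g = 0.
  have fg0 : (f : A) * (g : A) = 0 by exact: fg.
  by rewrite -(chiM (D k) Df Dg) fg0 /chi mulr0 xcoef0.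
have chi0 k : preg k -> k != l -> chi (D k) f = 0 /\ chi (D k) g = 0.
  move=> rk nk; have := chi_fg k rk; rewrite (negPf nk) => /eqP.
  (* The two values are opposite, so their product is minus a square. *)
  rewrite addr_eq0 => /eqP e1; have := chi_prod k; rewrite e1 mulNr => /eqP.
  by rewrite oppr_eq0 mulf_eq0 orbb => /eqP ->; rewrite oppr0.
have [fl|fl] := idem_chi (D l) Df ff; [left|right]; apply: idem_eq0 => // k rk.
  by case: (eqVneq k l) => [->//|nk]; have [] := chi0 k rk nk.
case: (eqVneq k l) => [->|nk]; last by have [] := chi0 k rk nk.
by have := chi_prod l; rewrite fl mul1r.
Qed.

(** The complement of the sum is an idempotent killed by all characters. *)
Lemma good_sum1 e : good (preg_parts p n) e -> \sum_(l <- preg_parts p n) e l = 1.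
Proof.
move=> ge; have up : uniq (preg_parts p n) by apply/filter_uniq/compositions_uniq.
have DE := good_sum_inD ge; have EE := good_sum_idem up ge.
apply/esym/eqP; rewrite -subr_eq0; apply/eqP; apply: idem_eq0.
- by apply: inD_sub => //; apply: inD1.
- by rewrite mulrBr mulr1 mulrBl mul1r EE subrr subr0.
by move=> l rl; rewrite chiB chi1 (good_sum_chi up ge) // mem_preg_parts rl subrr.
Qed.

Lemma good_lincomb e l : good (preg_parts p n) e -> preg l ->
  exists a : seq nat -> F,
    [/\ e l = lincomb a (Xi F n), a l = ((mult_fact l)%:R)^-1,
        forall xi, xi \in compositions n -> xi != l -> a xi != 0 -> strict_weak_refines xi l &
        lincomb a (perm_char F n) = char_fun F n p l].
Proof.
move=> ge rl; have ls : l \in preg_parts p n by rewrite mem_preg_parts.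
have De := good_inD ge ls; have [g1 _ _ g4] := ge; have lowe := g1 l ls.
have cl := preg_comp rl.
have xcoefE E : xcoef E (e l) = ((mult_fact l)%:R)^-1 * (E == D l)%:R + xcoef E (e l - lead l).
  by rewrite xcoefB /lead xcoefZ xcoef_XI addrC subrK.
exists (fun q => xcoef (D q) (e l)); split.
- rewrite lincomb_Xi {1}(inD_coef De).
  by apply: eq_bigr => E _; rewrite comp_of_K.
- rewrite xcoefE eqxx mulr1 (xcoef_span0 lowe) ?addr0 //.
  by rewrite /lower /= ltnn andbF.
- move=> xi; rewrite mem_compositions => cxi ne.
  have nD : (D xi == D l) = false.
    by apply: contraNF ne => /eqP/(congr1 (@comp_of m)); rewrite !Dset_K // => ->.
  rewrite xcoefE nD mulr0 add0r => nz.
  have /andP[w lt] : lower l (D xi).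
    by apply: contraNT nz => nlow; rewrite (xcoef_span0 lowe nlow).
  split; first exact: (WR_weak_refines cxi cl w).
  apply/negP=> /perm_size; rewrite (blk_size cxi) (blk_size cl) => -[e0].
  by move: lt; rewrite e0 ltnn.
apply/ffunP=> g; rewrite !ffunE sum_compositions.
have [k rk ck] := in_pclass_ex pp pchF g.
(* The image of [e l] under the Solomon epimorphism, evaluated at [g], is the character of [e l] at
   the [p]-regular partition [k] of the class of [g]. *)
transitivity (chi (D k) (e l)).
  rewrite chi_coef //; apply: eq_bigr => E _; rewrite comp_of_K perm_charE ?comp_of_comp //.
  by rewrite comp_of_K (in_pclass_fixc pchF E (preg_partition rk) ck).
rewrite (g4 l k ls rk); case: (eqVneq k l) => [<-|nk]; first by rewrite ck.
case: (boolP (in_pclass p l g)) => // c; case/eqP: nk.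
apply: (phi_preg_inj pchF rk rl) => G.
by rewrite -(in_pclass_fixc pchF G (preg_partition rk) ck)
  -(in_pclass_fixc pchF G (preg_partition rl) c).
Qed.

End Main.

Theorem mainTheorem1 (F : fieldType) (p n : nat)
  (hp : prime p) (hchar : p \in [pchar F])
  (hinf : forall s : seq F, exists x : F, x \notin s)
  (hn : (0 < n)%N) :
  exists e : seq nat -> {ffun 'S_n -> F},
    [/\ forall l, preg_part p n l -> primitive_idem (e l),
        forall l m, preg_part p n l -> preg_part p n m -> l != m ->
          ga_mul (e l) (e m) = 0,
        \sum_(l <- preg_parts p n) e l = ga_one F n &
        forall l, preg_part p n l ->
          exists a : seq nat -> F,
            [/\ e l = lincomb a (Xi F n),
                a l = ((mult_fact l)%:R)^-1,
                forall xi, xi \in compositions n -> xi != l -> a xi != 0 ->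
                  strict_weak_refines xi l &
                lincomb a (perm_char F n) = char_fun F n p l]].
Proof.
case: n hn => // m _; have [e ge] := good_ex m hp hchar; exists e; split.
- by move=> l; apply: good_primitive hp hchar _ _ ge.
- have [_ _ g3 _] := ge.
  by move=> l k rl rk; apply: g3; rewrite mem_preg_parts.
- exact: good_sum1 hp hchar _ ge.
- by move=> l; apply: good_lincomb hp hchar _ _ ge.
Qed.
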